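(* Suppose that $(K,v,\ldots)$ is a 1-$h$-minimal expansion of a henselian valued field of characteristic $0$, or is a pure algebraically closed valued field of characteristic $p$ (with $p>0$). Let $G$ be an infinite definable and definably almost simple subgroup of $\mathrm{SL}_n(K)$. Then $G$ is not bounded.
   Context: Conventions. The valuation $v\colon K\to\Gamma\cup\{\infty\}$ is non-trivial and surjective, $\Gamma$ an arbitrary totally ordered abelian group (not necessarily archimedean). $(K,v)$ is viewed as a first-order structure whose only non-imaginary sort is $K$, in the language $L_{\mathrm{div}}=(+,-,\cdot,0,1,\mathrm{div})$, where $\mathrm{div}(a,b)$ means $v(a)\le v(b)$ (''pure'' means no further structure); an expansion $(K,v,\ldots)$ is a structure in a language $L\supseteq L_{\mathrm{div}}$. ''Definable'' means definable with parameters in the given structure. A definable group is definably almost simple if it has no proper infinite definable normal subgroup. A subset of $K^m$ is bounded if there is $\gamma\in\Gamma$ such that $v(x_i)>\gamma$ for all of its elements $x$ and all coordinates $i$; a subgroup of $\mathrm{SL}_n(K)$ is bounded if it is bounded as a subset of $K^{n^2}$. 1-$h$-minimality. For $0\le\lambda\in\Gamma$ let $I_\lambda=\{x\in K: v(x)>\lambda\}$, $\mathrm{RV}_\lambda=K^\times/(1+I_\lambda)\cup\{0\}$, $\mathrm{rv}_\lambda\colon K\to \mathrm{RV}_\lambda$ the natural map, $\mathrm{rv}_\lambda(0)=0$. A finite $C\subset K$ $\lambda$-prepares $X\subset K$ if for all $x,x'\in K$ with $\mathrm{rv}_\lambda(x-c)=\mathrm{rv}_\lambda(x'-c)$ for all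 $c\in C$, $x\in X\Leftrightarrow x'\in X$. A theory $T$ of valued fields of characteristic $0$ in $L\supseteq L_{\mathrm{div}}$ is 1-$h$-minimal if for all $K\models T$, integers $n\ge1$, $0<\lambda\in\Gamma$, $A\subset K$, $\xi\in \mathrm{RV}_\lambda$, and every $X\subset K$ definable with parameters from $A\cup \mathrm{RV}_{v(n)}\cup\{\xi\}$, there is an integer $m\ge1$ such that $X$ is $(\lambda+v(m))$-prepared by a finite $A$-definable $C\subset K$. A structure is 1-$h$-minimal if its theory is. *)

(* Defs.v *)
From mathcomp Require Import all_boot all_order all_algebra.
From mathcomp Require Import boolp classical_sets functions cardinality.

Set Implicit Arguments.
Unset Strict Implicit.
Unset Printing Implicit Defensive.

Import Order.TTheory GRing.Theory Num.Theory.
Local Open Scope classical_set_scope.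
Local Open Scope ring_scope.

Record signature := Signature {
  fsym : Type;
  farity : fsym -> nat;
  rsym : Type;
  rarity : rsym -> nat
}.

(* The disjoint union; a language extending L1 is one of the form L1 + L2. *)
Definition signature_sum (L1 L2 : signature) : signature := {|
  fsym := (fsym L1 + fsym L2)%type;
  farity f := match f with inl g => farity g | inr g => farity g end;
  rsym := (rsym L1 + rsym L2)%type;
  rarity r := match r with inl s => rarity s | inr s => rarity s end
|}.

Record structure_on (L : signature) (M : Type) := StructureOn {
  fint : forall f : fsym L, ('I_(farity f) -> M) -> M;
  rint : forall r : rsym L, ('I_(rarity r) -> M) -> Prop
}.

Definition structure_sum (L1 L2 : signature) (M : Type)
    (S1 : structure_on L1 M) (S2 : structure_on L2 M) :
    structure_on (signature_sum L1 L2) M := {|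
  fint f := match f return ('I_(@farity (signature_sum L1 L2) f) -> M) -> M with
            | inl g => @fint _ _ S1 g
            | inr g => @fint _ _ S2 g
            end;
  rint r := match r return
                  ('I_(@rarity (signature_sum L1 L2) r) -> M) -> Prop with
            | inl s => @rint _ _ S1 s
            | inr s => @rint _ _ S2 s
            end
|}.

(* [term L n] and [formula L n] have their free variables among the n
   variables indexed by 'I_n; the other connectives and the existential
   quantifier are obtained from these classically. *)
Inductive term (L : signature) (n : nat) : Type :=
| TVar of 'I_n
| TApp (f : fsym L) of ('I_(farity f) -> term L n).

Inductive formula (L : signature) : nat -> Type :=
| FFalse n : formula L n
| FEq n of term L n & term L n : formula L n
| FRel n (r : rsym L) of ('I_(rarity r) -> term L n) : formula L n
| FImp n of formula L n & formula L n : formula L n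
| FAll n of formula L n.+1 : formula L n.

(* The quantifier [FAll] binds the variable of index 0 and shifts the others. *)
Definition env_cons (M : Type) n (a : M) (e : 'I_n -> M) : 'I_n.+1 -> M :=
  fun i => oapp e a (unlift ord0 i).

Definition env_cat (M : Type) m n (x : 'I_m -> M) (a : 'I_n -> M) :
    'I_(m + n) -> M :=
  fun i => match fintype.split i with inl j => x j | inr j => a j end.

Fixpoint teval (L : signature) (M : Type) (S : structure_on L M) n
    (e : 'I_n -> M) (t : term L n) : M :=
  match t with
  | TVar i => e i
  | TApp f ts => fint S (fun i => teval S e (ts i))
  end.

Fixpoint holds (L : signature) (M : Type) (S : structure_on L M) n
    (phi : formula L n) : ('I_n -> M) -> Prop :=
  match phi with
  | FFalse _ => fun _ => False
  | FEq _ s t => fun e => teval S e s = teval S e t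
  | FRel _ _ ts => fun e => rint S (fun i => teval S e (ts i))
  | FImp _ p q => fun e => holds S p e -> holds S q e
  | FAll _ p => fun e => forall a, holds S p (env_cons a e)
  end.

Definition sentence (L : signature) := formula L 0.

Definition satisfies (L : signature) (M : Type) (S : structure_on L M)
    (phi : sentence L) : Prop :=
  forall e : 'I_0 -> M, holds S phi e.

Definition models (L : signature) (M : Type) (S : structure_on L M)
    (T : set (sentence L)) : Prop :=
  forall phi, T phi -> satisfies S phi.

Definition theory_of (L : signature) (M : Type) (S : structure_on L M) :
    set (sentence L) :=
  [set phi | satisfies S phi].

Definition definable_over (L : signature) (M : Type) (S : structure_on L M)
    (A : set M) m (X : set ('I_m -> M)) : Prop :=
  exists k (phi : formula L (m + k)) (a : 'I_k -> M),
    (forall i, A (a i)) /\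
    forall x, X x <-> holds S phi (env_cat x a).

Definition definable (L : signature) (M : Type) (S : structure_on L M) m
    (X : set ('I_m -> M)) : Prop :=
  definable_over S [set: M] X.

(* X is definable with parameters from A and from the imaginaries in E. An
   imaginary is given by the equivalence class, a nonempty subset of M, that it
   names; a formula uses it through a representative, whose choice must not
   matter. *)
Definition eq_definable_over (L : signature) (M : Type) (S : structure_on L M)
    (A : set M) (E : set (set M)) m (X : set ('I_m -> M)) : Prop :=
  exists k l (phi : formula L (m + (k + l))) (a : 'I_k -> M)
      (xi : 'I_l -> set M),
    [/\ (forall i, A (a i)),
        (forall j, E (xi j)) &
        forall b : 'I_l -> M, (forall j, xi j (b j)) ->
          forall x, X x <-> holds S phi (env_cat x (env_cat a b))].

Definition set_as_unary (M : Type) (X : set M) : set ('I_1 -> M) :=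
  [set x | X (x ord0)].

Record orderedGroupType := OrderedGroup {
  og_sort :> porderZmodType;
  og_total : total (<=%R : rel og_sort);
  og_translate : forall x y z : og_sort, x <= y -> x + z <= y + z
}.

(* Gamma together with a largest element oo, represented by [None]. *)
Section Extended.
Variable Gamma : orderedGroupType.
Implicit Types x y : option Gamma.

Definition le_oo x y : bool :=
  match x, y with
  | _, None => true
  | None, Some _ => false
  | Some a, Some b => a <= b
  end.

Definition lt_oo x y : bool := ~~ le_oo y x.

Definition add_oo x y : option Gamma :=
  match x, y with
  | Some a, Some b => Some (a + b)
  | _, _ => None
  end.

Definition min_oo x y : option Gamma := if le_oo x y then x else y.

End Extended.

Record valuation (K : fieldType) (Gamma : orderedGroupType) := Valuation {
  val_fun :> K -> option Gamma;
  val_eq_oo : forall x, val_fun x = None <-> x = 0;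
  val_mul : forall x y, val_fun (x * y) = add_oo (val_fun x) (val_fun y);
  val_add : forall x y,
    le_oo (min_oo (val_fun x) (val_fun y)) (val_fun (x + y));
  val_surj : forall g : Gamma, exists x, val_fun x = Some g;
  val_nontriv : exists2 x, x != 0 & val_fun x <> Some 0
}.

Inductive Ldiv_fsym := SAdd | SOpp | SMul | SZero | SOne.
Inductive Ldiv_rsym := SDiv.

Definition Ldiv : signature := {|
  fsym := Ldiv_fsym;
  farity f := match f with SAdd | SMul => 2 | SOpp => 1 | SZero | SOne => 0 end;
  rsym := Ldiv_rsym;
  rarity _ := 2
|}.

Definition Ldiv_structure (K : fieldType) (Gamma : orderedGroupType)
    (v : valuation K Gamma) : structure_on Ldiv K := {|
  fint f := match f return ('I_(@farity Ldiv f) -> K) -> K with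
            | SAdd => fun x => x ord0 + x ord_max
            | SOpp => fun x => - x ord0
            | SMul => fun x => x ord0 * x ord_max
            | SZero => fun _ => 0
            | SOne => fun _ => 1
            end;
  rint r := fun x : 'I_2 -> K => le_oo (v (x ord0)) (v (x ord_max))
|}.

(* A valued field expanded by an interpretation of the further symbols in L. *)
Record valued_expansion (L : signature) := ValuedExpansion {
  vf_field :> fieldType;
  vf_group : orderedGroupType;
  vf_val : valuation vf_field vf_group;
  vf_extra : structure_on L vf_field
}.

Definition vf_language (L : signature) := signature_sum Ldiv L.

Definition vf_structure (L : signature) (K : valued_expansion L) :
    structure_on (vf_language L) K :=
  structure_sum (Ldiv_structure (vf_val K)) (vf_extra K).

Definition pure (L : signature) (K : valued_expansion L) : Prop :=
  (fsym L -> False) /\ (rsym L -> False).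

Section ValuedFieldNotions.
Variables (K : fieldType) (Gamma : orderedGroupType) (v : valuation K Gamma).

(* Hensel's lemma: simple residual roots lift. *)
Definition henselian : Prop :=
  forall (f : {poly K}) (a : K),
    (forall i, le_oo (Some 0) (v f`_i)) ->
    le_oo (Some 0) (v a) ->
    lt_oo (Some 0) (v f.[a]) ->
    v f^`().[a] = Some 0 ->
    exists b, [/\ le_oo (Some 0) (v b), f.[b] = 0 & lt_oo (Some 0) (v (b - a))].

Definition I_ideal (lam : Gamma) : set K := [set x | lt_oo (Some lam) (v x)].

(* rv_lam x is the coset x (1 + I_lam), an element of K^* / (1 + I_lam), if x is
   nonzero; the extra element 0 of RV_lam is the singleton {0}. The definition
   is meant for lam >= 0. *)
Definition rv (lam : Gamma) (x : K) : set K :=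
  [set x * (1 + u) | u in I_ideal lam].

Definition RV (lam : Gamma) : set (set K) := range (rv lam).

Definition prepares (lam : Gamma) (C X : set K) : Prop :=
  forall x x' : K,
    (forall c, C c -> rv lam (x - c) = rv lam (x' - c)) -> (X x <-> X x').

Definition bounded m (X : set ('I_m -> K)) : Prop :=
  exists g : Gamma, forall x, X x -> forall i, lt_oo (Some g) (v (x i)).

End ValuedFieldNotions.

(* Parameters from RV_lam: lam itself need not be given as a parameter, since
   lam = v(a) can be read off from rv_{v(n)}(a). *)
Definition one_h_minimal_theory (L : signature)
    (T : set (sentence (vf_language L))) : Prop :=
  forall K : valued_expansion L, models (vf_structure K) T ->
  forall (n : nat) (nu : vf_group K), (1 <= n)%N ->
    vf_val K n%:R = Some nu ->
  forall lam : vf_group K, 0 < lam ->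
  forall (A : set K) (xi : set K), RV (vf_val K) lam xi ->
  forall X : set K,
    eq_definable_over (vf_structure K) A (RV (vf_val K) nu `|` [set xi])
      (set_as_unary X) ->
  exists (m : nat) (mu : vf_group K) (C : set K),
    [/\ (1 <= m)%N, vf_val K m%:R = Some mu,
        finite_set C,
        definable_over (vf_structure K) A (set_as_unary C) &
        prepares (vf_val K) (lam + mu) C X].

Definition one_h_minimal (L : signature) (K : valued_expansion L) : Prop :=
  one_h_minimal_theory (theory_of (vf_structure K)).

Section MatrixGroups.
Variables (K : fieldType) (n : nat).
Implicit Types G H : set 'M[K]_n.

Definition SL : set 'M[K]_n := [set g | \det g = 1].

Definition is_subgroup_SL G : Prop :=
  [/\ G `<=` SL, G 1%:M,
      (forall g h, G g -> G h -> G (g *m h)) &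
      (forall g, G g -> G (invmx g))].

Definition normal_subgroup H G : Prop :=
  [/\ is_subgroup_SL H, H `<=` G &
      forall g h, G g -> H h -> H (g *m h *m invmx g)].

(* The identification of n x n matrices with K^(n^2). *)
Definition mx_coords (g : 'M[K]_n) : 'I_(n * n) -> K := fun i => mxvec g 0 i.

End MatrixGroups.

Definition definable_mx (L : signature) (K : valued_expansion L) n
    (G : set 'M[K]_n) : Prop :=
  definable (vf_structure K) (@mx_coords K n @` G).

Definition bounded_mx (L : signature) (K : valued_expansion L) n
    (G : set 'M[K]_n) : Prop :=
  bounded (vf_val K) (@mx_coords K n @` G).

Definition definably_almost_simple (L : signature) (K : valued_expansion L) n
    (G : set 'M[K]_n) : Prop :=
  ~ exists H : set 'M[K]_n,
      [/\ normal_subgroup H G, H <> G, infinite_set H & definable_mx H].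

(* Main.v *)
Require Import Defs.
From mathcomp Require Import all_boot all_order all_algebra.
From mathcomp Require Import ring.
From mathcomp Require Import boolp classical_sets functions cardinality.

Set Implicit Arguments.
Unset Strict Implicit.
Unset Printing Implicit Defensive.

Import Order.TTheory GRing.Theory Num.Theory.
Local Open Scope classical_set_scope.
Local Open Scope ring_scope.

(* Bounded groups have many normal subgroups: for c in the valuation ring, the
   elements h of G all of whose G-conjugates are congruent to 1 beyond c form a
   definable normal subgroup, which is proper for suitable c. As G is bounded it
   contains a neighbourhood of 1 in G, so it is infinite unless G is discrete,
   and then G is uniformly discrete because it is bounded.

   An infinite uniformly discrete definable subset of K^m does not exist as soon
   as infinite definable subsets of K contain balls. 1-h-minimality gives such
   balls directly. For a pure algebraically closed valued field they come from
   quantifier elimination. To eliminate "exists y", let r be a root closest to y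
   of the polynomials involved; the truth value at y is that at r + t u, where u
   runs through finitely many residues and v(t) through finitely many test values
   determined by the Taylor coefficients at r, so that only quantifiers over
   roots remain. The number of roots of P with v(p) <= v(q) is read off the
   valuations of the coefficients of the norm of p + T q, and conjunctions of
   such conditions are reduced to single ones after an infinitesimal perturbation
   that makes all values nonzero. *)

(** * The divisibility preorder of a valuation *)

(** A constant b with v(g_ij) >= v(b) for all g in G also bounds the inverses, as G contains them.
    Hence k (h - 1) k^-1 is small as soon as h - 1 is, uniformly in k, which puts every h close to 1
    into the normal subgroup. Moreover g^-1 g' - 1 = g^-1 (g' - g), so a gap around 1 becomes a gap
    between any two elements.

    A projection of a uniformly discrete set need not be uniformly discrete, so finiteness does not
    pass from one coordinate to the next by itself. A ball inside a projection is what allows one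
    coordinate to be traded for the others.

    In the algebraically closed case the obstacle is that a single root does not depend polynomially
    on the parameters, whereas norms, being symmetric in the roots, do up to a power of the leading
    coefficient. A statement about some root therefore has to become a statement about numbers of
    roots. Norms require a fixed degree and the combination of several conditions requires nonzero
    values, whence the splitting by degree and the perturbation. *)

Section Divisibility.
Variables (K : fieldType) (Gamma : orderedGroupType) (v : valuation K Gamma).

(** Inequalities in Gamma with oo are pulled back to K, where 0 is the largest element: [1 <=v x]
    says that x is integral, and [~~ (x <=v y)] is the strict inequality v(y) < v(x). *)
Definition dv (x y : K) : bool := le_oo (v x) (v y).
Local Notation "x <=v y" := (dv x y) (at level 70).

Lemma dv_refl x : x <=v x.
Proof. by rewrite /dv /le_oo; case: (v x). Qed.

Lemma dv_trans y x z : x <=v y -> y <=v z -> x <=v z.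
Proof.
rewrite /dv /le_oo; case: (v x) => [a|]; case: (v y) => [b|]; case: (v z) => [c|] //.
exact: le_trans.
Qed.

Lemma dv_total x y : (x <=v y) || (y <=v x).
Proof.
rewrite /dv /le_oo; case: (v x) => [a|]; case: (v y) => [b|] //.
exact: og_total.
Qed.

Lemma dvNge x y : ~~ (x <=v y) -> y <=v x.
Proof. by have /orP[->|] := dv_total x y. Qed.

Lemma dvr0 x : x <=v 0.
Proof. by rewrite /dv (val_eq_oo v 0).2 // /le_oo; case: (v x). Qed.

Lemma dv0r x : (0 <=v x) = (x == 0).
Proof.
apply/idP/eqP => [|->]; last exact: dv_refl.
rewrite /dv (val_eq_oo v 0).2 //= => h; apply/(val_eq_oo v).
by case: (v x) h.
Qed.

Lemma dv_neq0 x y : x <=v y -> y != 0 -> x != 0.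
Proof. by move=> h; apply: contraNneq => x0; rewrite -dv0r -x0. Qed.

Lemma og_leD2r (a b c : Gamma) : (a + c <= b + c) = (a <= b).
Proof.
apply/idP/idP; last exact: og_translate.
by move=> /(og_translate (- c)); rewrite !addrK.
Qed.

Lemma dvM2r z x y : z != 0 -> (x * z <=v y * z) = (x <=v y).
Proof.
move=> z0; rewrite /dv !val_mul.
case Ez: (v z) => [c|]; last first.
  by move/(val_eq_oo v): Ez => Ez; rewrite Ez eqxx in z0.
case: (v x) => [a|]; case: (v y) => [b|] //=.
exact: og_leD2r.
Qed.

Lemma dvM2l z x y : z != 0 -> (z * x <=v z * y) = (x <=v y).
Proof. by rewrite !(mulrC z); exact: dvM2r. Qed.

Lemma dvMr z x y : x <=v y -> x * z <=v y * z.
Proof.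
by have [->|z0] := eqVneq z 0; [rewrite !mulr0 dvr0 | rewrite dvM2r].
Qed.

Lemma dvMl z x y : x <=v y -> z * x <=v z * y.
Proof. by rewrite !(mulrC z); exact: dvMr. Qed.

Lemma dvM a b c d : a <=v b -> c <=v d -> a * c <=v b * d.
Proof. by move=> ab cd; apply: dv_trans (dvMr c ab) (dvMl b cd). Qed.

Lemma dvM_ge1 a b : 1 <=v a -> 1 <=v b -> 1 <=v a * b.
Proof. by move=> ha hb; have := dvM ha hb; rewrite mulr1. Qed.

Lemma dvM_le1 a b : a <=v 1 -> b <=v 1 -> a * b <=v 1.
Proof. by move=> ha hb; have := dvM ha hb; rewrite mulr1. Qed.

Lemma dvX n x y : x <=v y -> x ^+ n <=v y ^+ n.
Proof.
by move=> xy; elim: n => [|n IH]; [exact: dv_refl | rewrite !exprS dvM].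
Qed.

Lemma dvD z x y : z <=v x -> z <=v y -> z <=v x + y.
Proof.
have := val_add v x y; rewrite /dv /min_oo => h zx zy.
have zm : le_oo (v z) (if le_oo (v x) (v y) then v x else v y) by case: ifP.
move: zm h; move: (if _ then _ else _) => m.
rewrite /le_oo; case: (v z) => [a|]; case: m => [b|]; case: (v (x + y)) => [c|] //.
exact: le_trans.
Qed.

Lemma dv1N1 : 1 <=v -1.
Proof.
have /orP[//|] := dv_total 1 (-1).
by rewrite -(@dvM2r (-1)) ?mulN1r ?opprK ?mul1r // oppr_eq0 oner_eq0.
Qed.

Lemma dvNr x y : (x <=v - y) = (x <=v y).
Proof.
have h u w : u <=v w -> u <=v - w.
  move=> uw; apply: dv_trans uw _.
  by rewrite -{1}[w]mul1r -mulN1r; apply: dvMr; exact: dv1N1.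
by apply/idP/idP; [move/h; rewrite opprK | apply: h].
Qed.

Lemma dvNl x y : (- x <=v y) = (x <=v y).
Proof.
have h u w : u <=v w -> - u <=v w.
  by apply: dv_trans; rewrite -dvNr dv_refl.
by apply/idP/idP; [move/h; rewrite opprK | apply: h].
Qed.

Lemma dvB z x y : z <=v x -> z <=v y -> z <=v x - y.
Proof. by move=> zx zy; apply: dvD; rewrite ?dvNr. Qed.

Lemma dv_sum z I (r : seq I) (P : pred I) (F : I -> K) :
  (forall i, P i -> z <=v F i) -> z <=v \sum_(i <- r | P i) F i.
Proof.
by move=> h; elim/big_ind: _ => //; [exact: dvr0 | exact: dvD].
Qed.

Lemma dvD_lt z x y : ~~ (x <=v z) -> ~~ (y <=v z) -> ~~ (x + y <=v z).
Proof.
wlog xy : x y / x <=v y.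
  by have /orP[|h1 h2 h3] := dv_total x y; [auto | rewrite addrC; auto].
move=> xz _; apply: contra xz => h; apply: dv_trans h.
by apply: dvD => //; exact: dv_refl.
Qed.

Lemma dvDl z x y : ~~ (y <=v x) -> (x + y <=v z) = (x <=v z).
Proof.
move=> yx; apply/idP/idP; apply: dv_trans.
  by apply: dvD; [exact: dv_refl | exact: dvNge].
apply: contraNT yx => xyx; apply: contraT => yx.
by have := dvD_lt xyx (etrans (congr1 negb (dvNl y x)) yx); rewrite addrK dv_refl.
Qed.

Lemma dvDr z x y : ~~ (y <=v x) -> (z <=v x + y) = (z <=v x).
Proof.
move=> yx; apply/idP/idP => h.
  by apply: dv_trans h _; rewrite dvDl // dv_refl.
by apply: dvD => //; apply: dv_trans h _; exact: dvNge.
Qed.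

Lemma dvX2 n x y : (0 < n)%N -> (x ^+ n <=v y ^+ n) = (x <=v y).
Proof.
case: n => // n _; apply/idP/idP; last exact: dvX.
apply: contraTT => nxy; have yx := dvNge nxy.
have y0 : y != 0 by apply: contraNneq nxy => ->; exact: dvr0.
elim: n => [|n IH]; first by rewrite !expr1.
rewrite (exprS x) (exprS y); apply: contra IH => h.
rewrite -(@dvM2l y) //; apply: dv_trans h.
exact: dvMr.
Qed.

Lemma dv_neq0l x y : ~~ (x <=v y) -> y != 0.
Proof. by apply: contraNneq => ->; exact: dvr0. Qed.

Lemma dvV x y : x != 0 -> y != 0 -> (x^-1 <=v y^-1) = (y <=v x).
Proof.
move=> x0 y0; have xy0 : x * y != 0 by rewrite mulf_neq0.
by rewrite -(dvM2r _ _ xy0) mulKf // mulrC mulfK.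
Qed.

Lemma dv_prod I (r : seq I) (P : pred I) (F G : I -> K) :
  (forall i, P i -> F i <=v G i) ->
  \prod_(i <- r | P i) F i <=v \prod_(i <- r | P i) G i.
Proof.
by move=> h; elim/big_ind2: _ => //; [exact: dv_refl | move=> *; exact: dvM].
Qed.

Lemma valuation1 : v 1 = Some 0.
Proof.
have := val_mul v 1 1; rewrite mulr1; case E: (v 1) => [a|] /=.
  by case=> aa; congr Some; apply: (addrI a); rewrite addr0.
by move/(val_eq_oo v)/eqP: E; rewrite oner_eq0.
Qed.

Lemma exists_dv_gt1 : exists2 th, th != 0 & ~~ (th <=v 1).
Proof.
have [x x0 vx] := val_nontriv v.
have [h|] := boolP (x <=v 1); last by exists x.
exists x^-1; rewrite ?invr_eq0 //; apply: contra_notN vx => h'.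
have h2 : 1 <=v x by rewrite -dvV ?oner_neq0 ?invr1.
move: h h2; rewrite /dv valuation1; case E: (v x) => [a|] //= a0 a1.
by congr Some; apply: le_anti; rewrite a0 a1.
Qed.

End Divisibility.

(** * Quantifier-free definable sets *)

Definition env_tail (M : Type) n (e : 'I_n.+1 -> M) : 'I_n -> M :=
  fun i => e (lift ord0 i).

Lemma env_cons0 (M : Type) n (a : M) (e : 'I_n -> M) : env_cons a e ord0 = a.
Proof. by rewrite /env_cons unlift_none. Qed.

Lemma env_consS (M : Type) n (a : M) (e : 'I_n -> M) i :
  env_cons a e (lift ord0 i) = e i.
Proof. by rewrite /env_cons liftK. Qed.

Lemma env_consK (M : Type) n (a : M) (e : 'I_n -> M) :
  env_tail (env_cons a e) = e.
Proof. by apply/funext => i; rewrite /env_tail env_consS. Qed.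

Lemma env_cons_eta (M : Type) n (e : 'I_n.+1 -> M) :
  env_cons (e ord0) (env_tail e) = e.
Proof.
apply/funext => i; case: (unliftP ord0 i) => [j ->|->].
  by rewrite env_consS.
by rewrite env_cons0.
Qed.

Section PolyFun.
Variable K : fieldType.

Inductive polyfun n : (('I_n -> K) -> K) -> Prop :=
| polyfun_var i : polyfun (fun e => e i)
| polyfun_cst c : polyfun (fun _ => c)
| polyfun_add f g : polyfun f -> polyfun g -> polyfun (fun e => f e + g e)
| polyfun_mul f g : polyfun f -> polyfun g -> polyfun (fun e => f e * g e).

Lemma polyfun_ext n (f g : ('I_n -> K) -> K) :
  f =1 g -> polyfun f -> polyfun g.
Proof. by move=> /funext ->. Qed.

Lemma polyfun_opp n (f : ('I_n -> K) -> K) :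
  polyfun f -> polyfun (fun e => - f e).
Proof.
move=> hf; apply: polyfun_ext (polyfun_mul (polyfun_cst _ (-1)) hf) => e.
by rewrite mulN1r.
Qed.

Lemma polyfun_sum n I (r : seq I) (P : pred I) (F : I -> ('I_n -> K) -> K) :
  (forall i, P i -> polyfun (F i)) -> polyfun (fun e => \sum_(i <- r | P i) F i e).
Proof.
move=> h; elim: r => [|i r IH].
  by apply: polyfun_ext (polyfun_cst _ 0) => e; rewrite big_nil.
have [Pi|nPi] := boolP (P i).
  by apply: polyfun_ext (polyfun_add (h _ Pi) IH) => e; rewrite big_cons Pi.
by apply: polyfun_ext IH => e; rewrite big_cons (negPf nPi).
Qed.

Lemma polyfun_prod n I (r : seq I) (P : pred I) (F : I -> ('I_n -> K) -> K) :
  (forall i, P i -> polyfun (F i)) -> polyfun (fun e => \prod_(i <- r | P i) F i e).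
Proof.
move=> h; elim: r => [|i r IH].
  by apply: polyfun_ext (polyfun_cst _ 1) => e; rewrite big_nil.
have [Pi|nPi] := boolP (P i).
  by apply: polyfun_ext (polyfun_mul (h _ Pi) IH) => e; rewrite big_cons Pi.
by apply: polyfun_ext IH => e; rewrite big_cons (negPf nPi).
Qed.

Lemma polyfun_exp n (f : ('I_n -> K) -> K) k :
  polyfun f -> polyfun (fun e => f e ^+ k).
Proof.
move=> hf; elim: k => [|k IH].
  by apply: polyfun_ext (polyfun_cst _ 1) => e; rewrite expr0.
by apply: polyfun_ext (polyfun_mul hf IH) => e; rewrite exprS.
Qed.

Lemma polyfun_det n m (F : ('I_n -> K) -> 'M[K]_m) :
  (forall i j, polyfun (fun e => F e i j)) -> polyfun (fun e => \det (F e)).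
Proof.
move=> h; rewrite /determinant; apply: polyfun_sum => s _.
by apply: polyfun_mul; [exact: polyfun_cst | exact: polyfun_prod].
Qed.

Lemma polyfun_subst m n (f : ('I_m -> K) -> K) (s : 'I_m -> ('I_n -> K) -> K) :
  polyfun f -> (forall i, polyfun (s i)) -> polyfun (fun e => f (s^~ e)).
Proof.
move=> hf hs; elim: hf => [i|c|{}f g _ h1 _ h2|{}f g _ h1 _ h2] //.
- exact: polyfun_cst.
- exact: polyfun_add.
- exact: polyfun_mul.
Qed.

Lemma polyfun_tail n (f : ('I_n -> K) -> K) :
  polyfun f -> polyfun (fun e => f (env_tail e)).
Proof.
by move=> hf; apply: (polyfun_subst (s := fun i e => env_tail e i)) => // i; exact: polyfun_var.
Qed.

Lemma polyfun_env_cons m n (g : ('I_n -> K) -> K) (s : 'I_m -> ('I_n -> K) -> K) :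
  polyfun g -> (forall i, polyfun (s i)) ->
  forall i, polyfun (fun e => env_cons (g e) (s^~ e) i).
Proof.
move=> hg hs i; case: (unliftP ord0 i) => [j ->|->].
  by apply: polyfun_ext (hs j) => e; rewrite env_consS.
by apply: polyfun_ext hg => e; rewrite env_cons0.
Qed.

(** The size bound is uniform in [e], but the degree of [P e] may drop at special [e]. *)
Definition polyfam n (P : ('I_n -> K) -> {poly K}) : Prop :=
  (forall k, polyfun (fun e => (P e)`_k)) /\ exists d, forall e, (size (P e) <= d)%N.

Lemma polyfam_ext n (P Q : ('I_n -> K) -> {poly K}) :
  P =1 Q -> polyfam P -> polyfam Q.
Proof. by move=> /funext ->. Qed.

Lemma polyfam_polyC n (f : ('I_n -> K) -> K) :
  polyfun f -> polyfam (fun e => (f e)%:P).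
Proof.
move=> hf; split=> [[|k]|].
- by apply: polyfun_ext hf => e; rewrite coefC.
- by apply: polyfun_ext (polyfun_cst _ 0) => e; rewrite coefC.
- by exists 1%N => e; exact: size_polyC_leq1.
Qed.

Lemma polyfam_cst n (p : {poly K}) : polyfam (fun _ : 'I_n -> K => p).
Proof. by split=> [k|]; [exact: polyfun_cst | exists (size p)]. Qed.

Lemma polyfam_add n (P Q : ('I_n -> K) -> {poly K}) :
  polyfam P -> polyfam Q -> polyfam (fun e => P e + Q e).
Proof.
move=> [hP [d hd]] [hQ [d' hd']]; split=> [k|].
  by apply: polyfun_ext (polyfun_add (hP k) (hQ k)) => e; rewrite coefD.
exists (maxn d d') => e; apply: leq_trans (size_polyD _ _) _.
by rewrite geq_max !leq_max hd hd' orbT.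
Qed.

Lemma polyfam_mul n (P Q : ('I_n -> K) -> {poly K}) :
  polyfam P -> polyfam Q -> polyfam (fun e => P e * Q e).
Proof.
move=> [hP [d hd]] [hQ [d' hd']]; split=> [k|].
  under [X in polyfun X]funext do rewrite coefM.
  by apply: polyfun_sum => i _; exact: polyfun_mul.
exists (d + d')%N => e; apply: leq_trans (size_polyMleq _ _) _.
by apply: leq_trans (leq_pred _) _; exact: leq_add.
Qed.

Lemma polyfun_horner n (P : ('I_n -> K) -> {poly K}) f :
  polyfam P -> polyfun f -> polyfun (fun e => (P e).[f e]).
Proof.
move=> [hP [d hd]] hf.
under [X in polyfun X]funext do rewrite (horner_coef_wide _ (hd _)).
by apply: polyfun_sum => i _; apply: polyfun_mul => //; exact: polyfun_exp.
Qed.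

Lemma polyfam_tail n (P : ('I_n -> K) -> {poly K}) :
  polyfam P -> polyfam (fun e => P (env_tail e)).
Proof.
move=> [hP [d hd]]; split=> [k|]; first exact: (polyfun_tail (hP k)).
by exists d.
Qed.

Lemma polyfun_coefs n (f : ('I_n.+1 -> K) -> K) : polyfun f ->
  exists2 P, polyfam P & forall a e, f (env_cons a e) = (P e).[a].
Proof.
elim=> [i|c|{}f g _ [P hP eP] _ [Q hQ eQ]|{}f g _ [P hP eP] _ [Q hQ eQ]].
- case: (unliftP ord0 i) => [j ->|->].
    exists (fun e => (e j)%:P); first by apply: polyfam_polyC; exact: polyfun_var.
    by move=> a e; rewrite env_consS hornerC.
  exists (fun=> 'X); first exact: polyfam_cst.
  by move=> a e; rewrite env_cons0 hornerX.
- exists (fun=> c%:P); first exact: polyfam_cst.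
  by move=> a e; rewrite hornerC.
- exists (fun e => P e + Q e); first exact: polyfam_add.
  by move=> a e; rewrite eP eQ hornerD.
- exists (fun e => P e * Q e); first exact: polyfam_mul.
  by move=> a e; rewrite eP eQ hornerM.
Qed.

End PolyFun.

Section QuantifierFree.
Variables (K : fieldType) (Gamma : orderedGroupType) (v : valuation K Gamma).

(** Equations require no constructor of their own: f = 0 is the condition [0 <=v f]. *)
Inductive qf n : (('I_n -> K) -> Prop) -> Prop :=
| qf_dv f g : polyfun f -> polyfun g -> qf (fun e => dv v (f e) (g e))
| qf_not X : qf X -> qf (fun e => ~ X e)
| qf_and X Y : qf X -> qf Y -> qf (fun e => X e /\ Y e).

Lemma qf_ext n (X Y : ('I_n -> K) -> Prop) :
  (forall e, X e <-> Y e) -> qf X -> qf Y.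
Proof. by move=> h; have -> : X = Y by apply/funext => e; exact/propext. Qed.

Lemma qf_or n (X Y : ('I_n -> K) -> Prop) :
  qf X -> qf Y -> qf (fun e => X e \/ Y e).
Proof.
move=> hX hY; apply: qf_ext (qf_not (qf_and (qf_not hX) (qf_not hY))) => e.
by rewrite not_andE !notK.
Qed.

Lemma qf_true n : qf (fun _ : 'I_n -> K => True).
Proof.
apply: qf_ext (qf_dv (polyfun_cst n 0) (polyfun_cst n 0)) => e.
by split=> // _; exact: dv_refl.
Qed.

Lemma qf_cst n (b : Prop) : qf (fun _ : 'I_n -> K => b).
Proof.
have [hb|hb] := pselect b; first by apply: qf_ext (qf_true n).
by apply: qf_ext (qf_not (qf_true n)).
Qed.

Lemma qf_eq0 n (f : ('I_n -> K) -> K) : polyfun f -> qf (fun e => f e = 0).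
Proof.
move=> hf; apply: qf_ext (qf_dv (polyfun_cst n 0) hf) => e.
by rewrite dv0r; split=> /eqP.
Qed.

Lemma qf_exists n (T : finType) (X : T -> ('I_n -> K) -> Prop) :
  (forall t, qf (X t)) -> qf (fun e => exists t, X t e).
Proof.
move=> hX.
suff h (s : seq T) : qf (fun e => exists2 t, t \in s & X t e).
  apply: qf_ext (h (enum T)) => e; split=> [[t _]|[t]]; first by exists t.
  by exists t => //; rewrite mem_enum.
elim: s => [|t s IH].
  by apply: qf_ext (qf_cst n False) => e; split=> // -[].
apply: qf_ext (qf_or (hX t) IH) => e; split=> [[h|[u us h]]|[u]].
- by exists t => //; rewrite mem_head.
- by exists u => //; rewrite inE us orbT.
by rewrite inE => /orP[/eqP->|us]; [left | right; exists u].
Qed.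

Lemma qf_forall n (T : finType) (X : T -> ('I_n -> K) -> Prop) :
  (forall t, qf (X t)) -> qf (fun e => forall t, X t e).
Proof.
move=> hX; have h := qf_not (qf_exists (fun t => qf_not (hX t))).
by apply: qf_ext h => e; rewrite -forallNE; split=> h t; move: (h t); rewrite notK.
Qed.

Lemma qf_subst m n (X : ('I_m -> K) -> Prop) (s : 'I_m -> ('I_n -> K) -> K) :
  qf X -> (forall i, polyfun (s i)) -> qf (fun e => X (s^~ e)).
Proof.
move=> hX hs; elim: hX => [f g hf hg|{}X _ IH|{}X Y _ IHX _ IHY].
- by apply: qf_dv; exact: polyfun_subst.
- exact: qf_not.
- exact: qf_and.
Qed.

(** Being quantifier-free relative to a condition [A] that is not itself known to be
    quantifier-free, such as the nonvanishing of polynomials at all roots of another one. *)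
Definition qf_on n (A X : ('I_n -> K) -> Prop) : Prop :=
  exists2 Y, qf Y & forall e, A e -> (Y e <-> X e).

Lemma qf_onW n (A X : ('I_n -> K) -> Prop) : qf X -> qf_on A X.
Proof. by exists X. Qed.

Lemma qf_on_ext n (A X Y : ('I_n -> K) -> Prop) :
  (forall e, A e -> (X e <-> Y e)) -> qf_on A X -> qf_on A Y.
Proof.
move=> h [Z hZ eZ]; exists Z => // e Ae.
by rewrite eZ // h.
Qed.

Lemma qf_on_not n (A X : ('I_n -> K) -> Prop) :
  qf_on A X -> qf_on A (fun e => ~ X e).
Proof.
move=> [Y hY eY]; exists (fun e => ~ Y e); first exact: qf_not.
by move=> e Ae; rewrite eY.
Qed.

Lemma qf_on_and n (A X Y : ('I_n -> K) -> Prop) :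
  qf_on A X -> qf_on A Y -> qf_on A (fun e => X e /\ Y e).
Proof.
move=> [X' hX eX] [Y' hY eY]; exists (fun e => X' e /\ Y' e); first exact: qf_and.
by move=> e Ae; rewrite eX // eY.
Qed.

Lemma qf_on_exists n (A : ('I_n -> K) -> Prop) (T : finType)
    (X : T -> ('I_n -> K) -> Prop) :
  (forall t, qf_on A (X t)) -> qf_on A (fun e => exists t, X t e).
Proof.
move=> hX; have /choice[Y hY] : forall t, exists Y, qf Y /\ forall e, A e -> (Y e <-> X t e).
  by move=> t; have [Y ? ?] := hX t; exists Y.
exists (fun e => exists t, Y t e); first by apply: qf_exists => t; exact: (hY t).1.
by move=> e Ae; split=> -[t]; exists t; apply/(hY t).2.
Qed.

Lemma qf_on_forall n (A : ('I_n -> K) -> Prop) (T : finType)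
    (X : T -> ('I_n -> K) -> Prop) :
  (forall t, qf_on A (X t)) -> qf_on A (fun e => forall t, X t e).
Proof.
move=> hX; have h := qf_on_not (qf_on_exists (fun t => qf_on_not (hX t))).
by apply: qf_on_ext h => e _; rewrite -forallNE; split=> h t; move: (h t); rewrite notK.
Qed.

End QuantifierFree.

(** * Counting roots by valuation conditions *)

Section ClosedRoots.
Variables (K : fieldType) (closedK : GRing.closed_field_axiom K).

Lemma closed_poly_normal (p : {poly K}) :
  exists rs : seq K, p = lead_coef p *: \prod_(r <- rs) ('X - r%:P).
Proof.
have [n] := ubnP (size p); elim: n p => // n IH p sp.
have [/size_poly1P[c c0 ->]|] := boolP (size p == 1%N).
  by exists [::]; rewrite big_nil lead_coefC alg_polyC.
move=> /(PreClosedField.closed_rootP closedK)[x /factor_theorem[q pq]].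
have [q0|q0] := eqVneq q 0.
  by exists [::]; rewrite pq q0 mul0r lead_coef0 scale0r.
have [|rs eq] := IH q.
  by move: sp; rewrite pq size_Mmonic ?monicXsubC // size_XsubC addn2.
exists (x :: rs).
by rewrite pq lead_coef_Mmonic ?monicXsubC // big_cons mulrC {1}eq scalerAr.
Qed.

(** Roots with multiplicity; for p = 0 the list is arbitrary. *)
Definition poly_roots (p : {poly K}) : seq K := sval (cid (closed_poly_normal p)).

Lemma poly_rootsE p : p = lead_coef p *: \prod_(r <- poly_roots p) ('X - r%:P).
Proof. exact: svalP (cid (closed_poly_normal p)). Qed.

Lemma mem_poly_roots p z : p != 0 -> (z \in poly_roots p) = root p z.
Proof.
by move=> p0; rewrite [in RHS](poly_rootsE p) rootZ ?lead_coef_eq0 // root_prod_XsubC.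
Qed.

Lemma size_poly_roots p : p != 0 -> size (poly_roots p) = (size p).-1.
Proof.
move=> p0; rewrite [in RHS](poly_rootsE p) size_scale ?lead_coef_eq0 //.
by rewrite size_prod_XsubC.
Qed.

Lemma horner_roots p z :
  p.[z] = lead_coef p * \prod_(r <- poly_roots p) (z - r).
Proof.
rewrite {1}(poly_rootsE p) hornerZ horner_prod; congr (_ * _).
by apply: eq_bigr => r _; rewrite hornerXsubC.
Qed.

Lemma poly_eq_horner (p q : {poly K}) : (forall a, p.[a] = q.[a]) -> p = q.
Proof.
move=> h; apply/eqP; rewrite -subr_eq0.
apply/contraT => /(PreClosedField.closed_nonrootP closedK)[x].
by rewrite /root hornerD hornerN h subrr eqxx.
Qed.

(** Factoring q rather than triangularizing M: q(M) is a constant times a product of matrices M - s,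
    and det(M - s) is up to sign the characteristic polynomial at s. *)
Lemma det_horner_mx m (M : 'M[K]_m.+1) (rs : seq K) (q : {poly K}) :
  char_poly M = \prod_(r <- rs) ('X - r%:P) ->
  \det (horner_mx M q) = \prod_(r <- rs) q.[r].
Proof.
move=> hM.
have srs : size rs = m.+1.
  by apply: succn_inj; rewrite -(size_prod_XsubC rs id) -hM size_char_poly.
have detB s : \det (M - s%:M) = \prod_(r <- rs) (r - s).
  have -> : M - s%:M = (-1) *: (s%:M - M) by rewrite scaleN1r opprB.
  rewrite detZ.
  have -> : \det (s%:M - M) = (char_poly M).[s].
    rewrite /char_poly -[RHS]/(horner_eval s _) -det_map_mx; congr (\det _).
    apply/matrixP => i j; rewrite !mxE /= /horner_eval hornerD hornerN hornerC.
    by rewrite hornerMn hornerX.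
  rewrite hM horner_prod -srs.
  elim: (rs) => [|r rs' IH]; first by rewrite !big_nil expr0 mul1r.
  rewrite !big_cons -IH /= exprS hornerXsubC mulrACA mulN1r opprB.
  by [].
under eq_bigr do rewrite horner_roots.
rewrite big_split /= {1}(poly_rootsE q) linearZ /= detZ.
rewrite [in LHS]rmorph_prod /=; congr (_ * _).
  by rewrite -srs big_const_seq count_predT iter_mulr_1.
rewrite exchange_big /=.
rewrite (big_morph _ (@det_mulmx _ _) (det1 _ _)).
by apply: eq_bigr => s _; rewrite rmorphB /= horner_mx_X horner_mx_C detB.
Qed.

Lemma char_poly_companion (p : {poly K}) d : p \is monic -> size p = d.+1 ->
  char_poly (\matrix_(i < d, j < d)
    if i == d.-1 :> nat then - p`_j else (i.+1 == j :> nat)%:R) = p.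
Proof.
move=> pm sp; have ed : d = (size p).-1 by rewrite sp.
by rewrite {}ed in sp *; exact: companionmxK.
Qed.

(* The companion matrix of [P], scaled by the leading coefficient of [P] so that
   its entries are polynomial. *)
Let scaled_companion (d : nat) (p : {poly K}) : 'M[K]_d :=
  \matrix_(i < d, j < d)
    if i == d.-1 :> nat then - p`_j else p`_d *+ (i.+1 == j :> nat).

Lemma polyfun_scaled_companion n (P : ('I_n -> K) -> {poly K}) d k :
  polyfam P ->
  forall i j, polyfun (fun e => (scaled_companion d.+1 (P e) ^+ k) i j).
Proof.
move=> [hP _]; elim: k => [|k IH] i j.
  by apply: polyfun_ext (polyfun_cst _ ((1 : 'M[K]_d.+1) i j)) => e; rewrite expr0.
under [X in polyfun X]funext do rewrite exprS mxE.
apply: polyfun_sum => l _; apply: polyfun_mul => //.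
under [X in polyfun X]funext do rewrite mxE.
case: (i == _ :> nat); first exact: polyfun_opp.
case: (i.+1 == l :> nat); first exact: hP.
exact: polyfun_cst.
Qed.

(** The product of Q over the roots of P is the norm of Q in K[X]/(P), that is, the determinant of Q
    at the companion matrix; the power of the leading coefficient clears denominators. *)
Lemma polyfun_norm n (P Q : ('I_n -> K) -> {poly K}) d :
  polyfam P -> polyfam Q ->
  exists2 f, polyfun f & exists N, forall e, size (P e) = d.+1 ->
    f e = (P e)`_d ^+ N * \prod_(r <- poly_roots (P e)) (Q e).[r].
Proof.
move=> hP [hQ [D hD]].
case: d => [|d].
  exists (fun=> 1); first exact: polyfun_cst.
  exists 0%N => e sP.
  rewrite expr0 mul1r (size0nil (s := poly_roots (P e))) ?big_nil //.
  by rewrite size_poly_roots ?sP // -size_poly_gt0 sP.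
(* With c the leading coefficient and C the companion matrix, the factor c^(D-k) complements the c^k
   hidden in the k-th power of the scaled matrix. Thus M e = c^D Q(C), and the determinant of size
   d+1 contributes the exponent D (d+1). *)
pose M e := \sum_(k < D) ((Q e)`_k * (P e)`_d.+1 ^+ (D - k)) *:
                scaled_companion d.+1 (P e) ^+ k.
exists (fun e => \det (M e)).
  apply: polyfun_det => i j; rewrite /M.
  under [X in polyfun X]funext do rewrite summxE.
  apply: polyfun_sum => k _.
  under [X in polyfun X]funext do rewrite mxE.
  apply: polyfun_mul; last exact: polyfun_scaled_companion.
  by apply: polyfun_mul => //; apply: polyfun_exp; exact: hP.1.
exists (D * d.+1)%N => e sP.
set c := (P e)`_d.+1.
have lc : lead_coef (P e) = c by rewrite lead_coefE sP.
have c0 : c != 0 by rewrite -lc lead_coef_eq0 -size_poly_gt0 sP.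
pose p := c^-1 *: P e.
have pm : p \is monic by rewrite monicE lead_coefZ lc mulVf.
have sp : size p = d.+2 by rewrite size_scale ?invr_eq0.
have pE : p = \prod_(r <- poly_roots (P e)) ('X - r%:P).
  by rewrite /p {1}(poly_rootsE (P e)) lc scalerA mulVf // scale1r.
have hC := char_poly_companion pm sp.
set C := (X in char_poly X) in hC.
have eC : scaled_companion d.+1 (P e) = c *: C.
  apply/matrixP => i j; rewrite !mxE; case: ifP => _.
    by rewrite coefZ mulrN mulrA divff ?mul1r.
  by rewrite mulr_natr.
rewrite pE in hC.
rewrite -(det_horner_mx _ hC) exprM -detZ; congr (\det _).
rewrite /M eC -[in RHS](take_poly_id (hD e)) /take_poly.
rewrite poly_def linear_sum scaler_sumr; apply: eq_bigr => k _.
rewrite linearZ /= rmorphXn /= horner_mx_X exprZn !scalerA; congr (_ *: _).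
by rewrite -mulrA -exprD subnK 1?ltnW // mulrC.
Qed.

Variables (Gamma : orderedGroupType) (v : valuation K Gamma).
Local Notation "x <=v y" := (dv v x y) (at level 70).

Lemma linear_prod_first_min (s : seq (K * K)) :
  {in s, forall ab, (ab.1 != 0) || (ab.2 != 0)} ->
  let p := \prod_(ab <- s) (ab.1%:P + ab.2 *: 'X) in
  let k := count (fun ab => ~~ (ab.1 <=v ab.2)) s in
  [/\ p`_k != 0, forall j, p`_k <=v p`_j & forall j, (j < k)%N -> ~~ (p`_j <=v p`_k)].
Proof.
elim: s => [|[a b] s IH] hs /=.
  by rewrite big_nil; split=> // [|j]; rewrite !coef1 ?oner_eq0 //; case: j => [|j];
    rewrite ?dv_refl ?dvr0.
have [|q0 qmin qlt] := IH; first by move=> x xs; apply: hs; rewrite inE xs orbT.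
have {hs} /= ab0 := hs (a, b) (mem_head _ _).
rewrite big_cons /=; set q := \prod_(ab <- s) _ in q0 qmin qlt *.
set k := count _ s in q0 qmin qlt *.
have cE j : ((a%:P + b *: 'X) * q)`_j = a * q`_j + b * (if j == 0%N then 0 else q`_j.-1).
  by rewrite mulrDl coefD coefCM -scalerAl coefZ coefXM.
have pred_min j : q`_k <=v (if j == 0%N then 0 else q`_j.-1).
  by case: eqP => _; [exact: dvr0 | exact: qmin].
have [ab|ab] := boolP (a <=v b); rewrite /= ?add0n ?add1n.
  have a0 : a != 0.
    by apply: contraTneq ab0 => a0; move: ab; rewrite a0 dv0r => ->; rewrite eqxx.
  have lt_k j : (j <= k)%N -> ~~ (b * (if j == 0%N then 0 else q`_j.-1) <=v a * q`_k).
    move=> jk; apply: contraNN q0 => h.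
    have {}h := dv_trans (dvMr _ ab) h; rewrite dvM2l // in h.
    by case: j jk h => [|j] jk /=; [rewrite dv0r | rewrite (negPf (qlt _ jk))].
  have eqk : ((a%:P + b *: 'X) * q)`_k <=v a * q`_k.
    by rewrite cE dvDl ?dv_refl // lt_k.
  split.
  - rewrite cE; apply: contraNneq (lt_k k (leqnn k)) => /eqP.
    rewrite addr_eq0 => /eqP ->; rewrite dvNr; exact: dv_refl.
  - move=> j; apply: dv_trans eqk _; rewrite cE; apply: dvD; first exact: dvMl.
    by apply: dvM.
  - move=> j jk; rewrite (cE k) dvDr ?lt_k // cE; apply: dvD_lt; first by rewrite dvM2l // qlt.
    by rewrite lt_k // ltnW.
have b0 : b != 0 := dv_neq0l ab.
have ba := dvNge ab.
have lt_k j : ~~ (a * q`_j <=v b * q`_k).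
  apply: contra ab => h; rewrite -(dvM2r _ _ _ q0); apply: dv_trans h.
  exact: dvMl.
have eqk : ((a%:P + b *: 'X) * q)`_k.+1 <=v b * q`_k.
  by rewrite cE /= [a * _ + _]addrC dvDl ?dv_refl // lt_k.
split.
- rewrite cE /= [a * _ + _]addrC; apply: contraNneq (lt_k k.+1) => /eqP.
  by rewrite addr_eq0 => /eqP ->; rewrite dvNr dv_refl.
- move=> j; apply: dv_trans eqk _; rewrite cE; apply: dvD; first by apply: dvM.
  exact: dvMl.
- move=> j jk; rewrite (cE k.+1) /= [a * _ + _]addrC dvDr ?lt_k // cE.
  apply: dvD_lt => //; rewrite dvM2l //.
  by case: eqP jk => [_ _|/eqP]; [rewrite dv0r | case: j => // j _ /= jk; exact: qlt].
Qed.

(** The first index of a minimal coefficient is unique, so comparisons between coefficients pin down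
    the count; the scalar [c] does not affect them. *)
Lemma count_linear_prod (s : seq (K * K)) (c : K) d k :
  {in s, forall ab, (ab.1 != 0) || (ab.2 != 0)} -> c != 0 -> size s = d ->
  let p := c *: \prod_(ab <- s) (ab.1%:P + ab.2 *: 'X) in
  count (fun ab => ~~ (ab.1 <=v ab.2)) s = k <->
  (forall j : 'I_d.+1, p`_k <=v p`_j) /\ (forall j : 'I_k, ~~ (p`_j <=v p`_k)).
Proof.
move=> hs c0 sd p; have [_ h1 h2] := linear_prod_first_min hs.
set k0 := count _ s in h1 h2 *.
have k0d : (k0 < d.+1)%N by rewrite ltnS -sd count_size.
have cp i j : (p`_i <=v p`_j) = ((\prod_(ab <- s) (ab.1%:P + ab.2 *: 'X))`_i <=v
   (\prod_(ab <- s) (ab.1%:P + ab.2 *: 'X))`_j).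
  by rewrite /p !coefZ dvM2l.
split=> [<-|[h3 h4]]; first by split=> j; rewrite cp //; exact: h2.
have [kk|kk|//] := ltngtP k0 k.
  by have := h4 (Ordinal kk); rewrite cp h1.
by have := h3 (Ordinal k0d); rewrite cp (negPf (h2 _ kk)).
Qed.

Lemma qf_count_atom n (A : ('I_n -> K) -> Prop) d P p q k :
  polyfam P -> polyfam p -> polyfam q ->
  (forall e, A e -> size (P e) = d.+1) ->
  (forall e r, A e -> root (P e) r -> ((p e).[r] != 0) || ((q e).[r] != 0)) ->
  qf_on v A (fun e =>
    count (fun r => ~~ ((p e).[r] <=v (q e).[r])) (poly_roots (P e)) = k).
Proof.
move=> hP hp hq hA hpq.
have hP' := polyfam_tail hP.
(* Variable 0 of the extended environment plays the role of T in p + T q. *)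
have hQ' : polyfam (fun e => p (env_tail e) + (e ord0)%:P * q (env_tail e)).
  apply: polyfam_add; first exact: polyfam_tail.
  by apply: polyfam_mul; [apply: polyfam_polyC; exact: polyfun_var | exact: polyfam_tail].
have [f hf [N ef]] := polyfun_norm d hP' hQ'.
have [R hR eR] := polyfun_coefs hf.
exists (fun e => (forall j : 'I_d.+1, (R e)`_k <=v (R e)`_j) /\
                 (forall j : 'I_k, ~ ((R e)`_j <=v (R e)`_k))).
  apply: qf_and; apply: qf_forall => j; first by apply: qf_dv; exact: hR.1.
  by apply: qf_not; apply: qf_dv; exact: hR.1.
move=> e Ae; have sP := hA e Ae.
have P0 : P e != 0 by rewrite -size_poly_gt0 sP.
pose s := [seq ((p e).[r], (q e).[r]) | r <- poly_roots (P e)].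
have -> : R e = (P e)`_d ^+ N *: \prod_(ab <- s) (ab.1%:P + ab.2 *: 'X).
  (* The polynomial [R e] in T is known only through its values; these determine it because K is
     infinite. *)
  apply: poly_eq_horner => a; rewrite -eR ef ?env_consK // env_cons0.
  rewrite hornerZ horner_prod big_map; congr (_ * _); apply: eq_bigr => r _ /=.
  by rewrite !(hornerE, hornerD) /= mulrC.
have ss : size s = d by rewrite size_map size_poly_roots // sP.
have hs : {in s, forall ab, (ab.1 != 0) || (ab.2 != 0)}.
  by move=> ab /mapP[r]; rewrite mem_poly_roots // => rr -> /=; exact: hpq.
have c0 : (P e)`_d ^+ N != 0.
  by rewrite expf_neq0 // -[d]/(d.+1.-1) -sP -lead_coefE lead_coef_eq0.
have := count_linear_prod k hs c0 ss; rewrite count_map => ->.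
by split=> -[h1 h2]; split=> // j; apply/negP; exact: h2.
Qed.

End ClosedRoots.

(** * Gauss norms and generic residues *)

Section GaussNorm.
Variables (K : fieldType) (closedK : GRing.closed_field_axiom K).
Variables (Gamma : orderedGroupType) (v : valuation K Gamma).
Local Notation "x <=v y" := (dv v x y) (at level 70).

Lemma dv_sum_lt z I (r : seq I) (F : I -> K) :
  z != 0 -> (forall i, ~~ (F i <=v z)) -> ~~ (\sum_(i <- r) F i <=v z).
Proof.
move=> z0 h; elim/big_ind: _ => //; first by rewrite dv0r.
by move=> x y; exact: dvD_lt.
Qed.

(* [p.[u]] has the valuation of a coefficient of [p] of minimal valuation. *)
Definition gauss_generic (p : {poly K}) (u : K) : Prop := forall k, p.[u] <=v p`_k.

Lemma dv_horner z (p : {poly K}) u :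
  1 <=v u -> (forall k, z <=v p`_k) -> z <=v p.[u].
Proof.
move=> u1 h; rewrite horner_coef; apply: dv_sum => i _.
rewrite -[z]mulr1; apply: dvM => //.
by rewrite -(expr1n _ i); exact: dvX.
Qed.

Lemma dv_coef_mul z w (p q : {poly K}) :
  (forall k, z <=v p`_k) -> (forall k, w <=v q`_k) -> forall k, z * w <=v (p * q)`_k.
Proof. by move=> hp hq k; rewrite coefM; apply: dv_sum => i _; exact: dvM. Qed.

(** Since u avoids the residues of the roots, v(u - s) is at most the minimum of 0 and v(s) for each
    root s. The sum of these minima, plus the valuation of the leading coefficient, is a lower bound
    for the valuation of every coefficient. *)
Lemma gauss_generic_roots (p : {poly K}) u :
  1 <=v u -> (forall s, root p s -> u - s <=v 1) -> gauss_generic p u.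
Proof.
move=> u1 hs; have [->|p0] := eqVneq p 0.
  by move=> k; rewrite horner0 coef0 dv_refl.
pose m s := if 1 <=v s then 1 else s.
pose M := \prod_(s <- poly_roots closedK p) m s.
have hu : p.[u] <=v lead_coef p * M.
  rewrite (horner_roots closedK); apply: dvMl.
  rewrite /M !big_seq; apply: dv_prod => s; rewrite mem_poly_roots // => /hs us.
  rewrite /m; case: ifP => // /negbT s1.
  rewrite addrC dvDl ?dvNl ?dv_refl // dvNr.
  by apply: contra s1; exact: dv_trans.
move=> k; apply: dv_trans hu _.
rewrite {2}(poly_rootsE closedK p) coefZ; apply: dvMl.
rewrite /M; elim: (poly_roots closedK p) k => [|s rs IH] k.
  by rewrite !big_nil coef1; case: (k == 0%N); [exact: dv_refl | exact: dvr0].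
rewrite !big_cons; apply: dv_coef_mul => // j.
rewrite coefB coefX coefC; apply: dvB; rewrite /m.
  case: (j == 1%N); last exact: dvr0.
  by case: ifP => [_|/negbT]; [exact: dv_refl | exact: dvNge].
case: (j == 0%N); last exact: dvr0.
by case: ifP => // _; exact: dv_refl.
Qed.

(** Representatives of pairwise distinct classes of the residue field. *)
Definition residue_list (us : seq K) : Prop :=
  all (fun u => 1 <=v u) us && pairwise (fun a b => a - b <=v 1) us.

(** As in Euclid's proof, a root x of 1 + prod (X - u) lies in a new residue class. It is integral,
    since otherwise all factors x - u would have negative valuation while their product is -1; being
    integral with product -1, the factors are then units. *)
Lemma exists_residue_list N : exists2 us, residue_list us & size us = N.
Proof.
elim: N => [|N [us /andP[u1 pu] sz]]; first by exists [::].
have [x /andP[x1 /allP xus]] :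
    exists x, (1 <=v x) && all (fun u => x - u <=v 1) us.
  case: us {pu sz} u1 => [|u0 us] u1; first by exists 0; rewrite dvr0.
  set s := u0 :: us in u1 *.
  pose f := \prod_(u <- s) ('X - u%:P) + 1.
  have [x] : exists x, root f x.
    apply/(PreClosedField.closed_rootP closedK); rewrite size_polyDl.
      by rewrite size_prod_XsubC.
    by rewrite size_poly1 size_prod_XsubC.
  rewrite /root hornerD hornerC horner_prod addr_eq0.
  under eq_bigr do rewrite hornerXsubC.
  move=> /eqP hx; exists x.
  have x1 : 1 <=v x.
    apply: contraT => nx1.
    have xu u : u \in s -> (x - u <=v x) && ~~ (1 <=v x - u).
      move=> us1; have hu : ~~ (- u <=v x).
        by rewrite dvNl; apply: contra nx1; apply: dv_trans; exact: (allP u1).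
      by rewrite dvDl // dv_refl dvDr.
    have : ~~ (1 <=v \prod_(u <- s) (x - u)).
      have {}xu u : u \in s -> x - u <=v 1 /\ ~~ (1 <=v x - u).
        by move=> /xu/andP[_ h]; split=> //; exact: dvNge.
      rewrite /s big_cons; have [h0 h1] := xu u0 (mem_head _ _).
      apply: contra h1 => /dv_trans; apply.
      rewrite -[X in _ <=v X]mulr1; apply: dvMl.
      rewrite big_seq; elim/big_ind: _ => [|a b|u us1]; [exact: dv_refl | exact: dvM_le1 | ].
      by have [] := xu u; rewrite // inE us1 orbT.
    by rewrite hx dvNr dv_refl.
  rewrite x1; apply/allP => u us1.
  have xu w : w \in s -> 1 <=v x - w.
    by move=> ws; apply: dvB => //; exact: (allP u1).
  have : \prod_(w <- s) (x - w) <=v 1 by rewrite hx dvNl dv_refl.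
  rewrite (big_rem u us1); apply: dv_trans.
  rewrite -{1}[x - u]mulr1; apply: dvMl.
  rewrite big_seq; elim/big_ind: _ => [|a b|w /mem_rem]; [exact: dv_refl | exact: dvM_ge1 | exact: xu].
exists (x :: us); rewrite /residue_list /= ?sz ?x1 ?u1 ?pu ?andbT //.
by apply/allP.
Qed.

(** Pigeonhole: each root of each polynomial rules out at most one residue of the list, and there
    are at most as many roots as the sum of the degrees. *)
Lemma exists_gauss_generic (ps : seq {poly K}) us : residue_list us ->
  (\sum_(p <- ps) (size p).-1 < size us)%N ->
  exists2 u, u \in us & forall p, p \in ps -> gauss_generic p u.
Proof.
move=> /andP[/allP u1 pu] sz.
pose S := flatten [seq poly_roots closedK p | p <- ps & p != 0].
pose bad s u := ~~ (u - s <=v 1).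
have sS : (size S <= \sum_(p <- ps) (size p).-1)%N.
  rewrite size_flatten sumnE /shape -map_comp big_map big_filter big_mkcond /=.
  by apply: leq_sum => p _; case: ifP => // p0; rewrite size_poly_roots.
have cnt1 s : (count (bad s) us <= 1)%N.
  elim: us pu {u1 sz} => //= a us IH /andP[/allP ha /IH {}IH].
  have [bas|_] := boolP (bad s a); last by rewrite add0n.
  rewrite (_ : count _ _ = 0%N) //; apply/eqP; rewrite -leqn0 leqNgt -has_count.
  apply/hasPn => b /ha ab; apply: contraL ab => bbs.
  have -> : a - b = (a - s) + - (b - s) by rewrite opprB addrA subrK.
  by apply: dvD_lt; rewrite ?dvNl.
have [u us1 hu] : exists2 u, u \in us & ~~ has (bad^~ u) S.
  apply/hasP; rewrite -[has _ us]negbK -all_predC; apply: contraL sz => /= hall.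
  rewrite -leqNgt; apply: leq_trans sS.
  have : count (fun u => has (bad^~ u) S) us = size us.
    by apply/eqP; rewrite -all_count; apply: sub_all hall => u /=; rewrite negbK.
  move=> <-; elim: S {hall} => [|s S IH] /=; first by rewrite count_pred0.
  rewrite -add1n -[X in (X <= _)%N]addn0; apply: leq_trans (leq_add (cnt1 s) IH).
  by rewrite -count_predUI leq_add.
exists u => // p pps; have [->|p0] := eqVneq p 0.
  by move=> k; rewrite horner0 coef0 dv_refl.
apply: gauss_generic_roots => [|s rs]; first exact: u1.
move/hasPn: hu => /(_ s); rewrite /bad negbK; apply.
apply/flatten_mapP; exists p; first by rewrite mem_filter p0.
by rewrite mem_poly_roots.
Qed.

(** At a generic point the valuation of a polynomial is the minimum over its coefficients. Two such
    minima are compared, which is why the points u and w may differ. *)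
Lemma gauss_generic_cmp (p q : {poly K}) u w N :
  1 <=v u -> 1 <=v w -> gauss_generic p u -> gauss_generic q w ->
  (size p <= N)%N -> (size q <= N)%N ->
  (p.[u] <=v q.[w]) = [forall l : 'I_N, exists k : 'I_N, p`_k <=v q`_l].
Proof.
move=> u1 w1 hp hq sp sq; apply/idP/forallP => [h l|h].
  have h' := dv_trans h (hq l).
  apply/existsP; have [p0|p0] := eqVneq p.[u] 0.
    by exists l; move: h'; rewrite p0 dv0r => /eqP ->; exact: dvr0.
  apply/existsP; apply: contraT; rewrite negb_exists => /forallP hk.
  have := @dv_sum_lt p.[u] _ (index_enum 'I_N) (fun k : 'I_N => p`_k * u ^+ k) p0.
  rewrite -(horner_coef_wide u sp) dv_refl; apply=> k; apply: contra (hk k) => h2.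
  apply: dv_trans (dv_trans _ h2) h'; rewrite -{1}[p`_k]mulr1; apply: dvMl.
  by rewrite -(expr1n _ k); exact: dvX.
apply: dv_horner => // l; have [lN|Nl] := ltnP l N; last first.
  by rewrite nth_default ?dvr0 // (leq_trans sq).
have /existsP[k hk] := h (Ordinal lN).
exact: dv_trans (hp k) hk.
Qed.

End GaussNorm.

(** * Infinitesimal perturbations *)

Section SmallPerturbation.
Variables (K : fieldType) (Gamma : orderedGroupType) (v : valuation K Gamma).
Local Notation "x <=v y" := (dv v x y) (at level 70).

(** The filter of punctured neighbourhoods of 0. The point 0 is left out because polynomials may
    vanish there together, which would falsify their comparison. *)
Definition near0 (Q : K -> Prop) : Prop :=
  exists2 d, d != 0 & forall x, x != 0 -> d <=v x -> Q x.

Lemma near0W (Q : K -> Prop) : (forall x, Q x) -> near0 Q.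
Proof. by move=> h; exists 1; rewrite ?oner_neq0. Qed.

Lemma near0_mono (Q Q' : K -> Prop) :
  (forall x, Q x -> Q' x) -> near0 Q -> near0 Q'.
Proof. by move=> h [d d0 hd]; exists d => // x x0 /hd; auto. Qed.

Lemma near0_ex (Q : K -> Prop) : near0 Q -> exists2 x, x != 0 & Q x.
Proof. by move=> [d d0 hd]; exists d => //; apply: hd (dv_refl _ _). Qed.

Lemma near0_and (Q Q' : K -> Prop) :
  near0 Q -> near0 Q' -> near0 (fun x => Q x /\ Q' x).
Proof.
move=> [d d0 hd] [d' d'0 hd']; have /orP[h|h] := dv_total v d d'.
  by exists d' => // x x0 dx; split; [apply: hd => //; exact: dv_trans dx | exact: hd'].
by exists d => // x x0 dx; split; [exact: hd | apply: hd' => //; exact: dv_trans dx].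
Qed.

Lemma near0_all (T : eqType) (s : seq T) (Q : T -> K -> Prop) :
  (forall t, t \in s -> near0 (Q t)) -> near0 (fun x => forall t, t \in s -> Q t x).
Proof.
elim: s => [|t s IH] h; first exact: near0W.
have h1 := h t (mem_head _ _).
have h2 := IH (fun u us => h u (mem_behead (s := t :: s) us)).
apply: near0_mono (near0_and h1 h2) => x [hx hx'] u.
by rewrite inE => /orP[/eqP->|] //; exact: hx'.
Qed.

(** A non-trivial ordered group has no largest element: multiplication by an element [th] of
    positive valuation leads beyond y. *)
Lemma near0_gt y : y != 0 -> near0 (fun x => ~~ (x <=v y)).
Proof.
move=> y0; have [th th0 th1] := exists_dv_gt1 v.
exists (y * th) => [|x _ h]; first by rewrite mulf_neq0.
apply: contra th1 => h'; rewrite -(dvM2l v _ _ y0) mulr1.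
exact: dv_trans h h'.
Qed.

Lemma near0_ge y : y != 0 -> near0 (fun x => y <=v x).
Proof. by move=> y0; apply: near0_mono (near0_gt y0) => x; exact: dvNge. Qed.

Lemma exists_lower_bound (s : seq K) :
  exists2 w, w != 0 & forall x, x \in s -> w <=v x.
Proof.
elim: s => [|y s [w w0 hw]]; first by exists 1; rewrite ?oner_neq0.
have [yw|wy] := boolP (y <=v w); last first.
  exists w => // x; rewrite inE => /orP[/eqP->|/hw//]; exact: dvNge.
exists y; first exact: dv_neq0 yw w0.
move=> x; rewrite inE => /orP[/eqP->|/hw]; [exact: dv_refl | exact: dv_trans].
Qed.

Lemma exists_upper_bound (s : seq K) :
  exists2 w, w != 0 & forall x, x \in s -> x != 0 -> x <=v w.
Proof.
have [w w0 hw] := exists_lower_bound [seq x^-1 | x <- s].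
exists w^-1; first by rewrite invr_eq0.
move=> x xs x0; rewrite -(dvV v) ?invr_eq0 // invrK.
by apply: hw; apply/mapP; exists x.
Qed.

Lemma near0_horner (p : {poly K}) y : y != 0 -> near0 (fun x => ~~ (p.[x] - p`_0 <=v y)).
Proof.
elim/poly_ind: p => [|p c _] y0.
  by apply: near0W => x; rewrite horner0 coef0 subr0 dv0r.
have [w w0 hw] := exists_lower_bound p.
have y'0 : y / w != 0 by rewrite mulf_neq0 ?invr_eq0.
apply: near0_mono (near0_and (near0_ge (oner_neq0 K)) (near0_gt y'0)) => x [x1 xy].
rewrite hornerMXaddC coefD coefMX coefC /= add0r addrK.
apply: contra xy => h; rewrite -(dvM2r v _ _ w0) divfK //; apply: dv_trans h.
rewrite mulrC; apply: dvMr.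
apply: dv_horner => // k; have [sk|ks] := leqP (size p) k.
  by rewrite nth_default ?dvr0.
by apply: hw; exact: mem_nth.
Qed.

(** The same e is added on both sides. A zero becomes e, whose valuation still exceeds that of any
    given nonzero element; two zeros remain equal; a nonzero element keeps its valuation. *)
Lemma near0_perturb x y :
  near0 (fun e => x + e != 0 /\ (x + e <=v y + e) = (x <=v y)).
Proof.
have ne z e : z != 0 -> ~~ (e <=v z) -> z + e != 0.
  by move=> z0 ez; apply: (@dv_neq0 _ _ v _ z) => //; rewrite dvDl // dv_refl.
have [->|x0] := eqVneq x 0; have [->|y0] := eqVneq y 0.
- by exists 1; rewrite ?oner_neq0 // => e e0 _; rewrite add0r !dv_refl.
- have [d d0 hd] := near0_gt y0; exists d => // e e0 /(hd _ e0) ey.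
  by rewrite add0r e0 dvDr // (negPf ey) dv0r (negPf y0).
- apply: near0_mono (near0_gt x0) => e ex; split; first exact: ne.
  by rewrite add0r dvDl // (dvNge ex) dvr0.
- apply: near0_mono (near0_and (near0_gt x0) (near0_gt y0)) => e [ex ey].
  by split; [exact: ne | rewrite dvDl // dvDr].
Qed.

(** The truth value of [p.[x] <=v q.[x]] as x tends to 0: common factors X are stripped off until
    the constant terms, no longer both zero, decide. When [d] runs out both polynomials vanish, and
    the comparison holds. *)
Fixpoint dv_near0 d (p q : {poly K}) : Prop :=
  if d isn't d'.+1 then True else
    ((p`_0 = 0 /\ q`_0 = 0) /\ dv_near0 d' (drop_poly 1 p) (drop_poly 1 q)) \/
    (~ (p`_0 = 0 /\ q`_0 = 0) /\ p`_0 <=v q`_0).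

Lemma dv_near0P d (p q : {poly K}) : (size p <= d)%N -> (size q <= d)%N ->
  near0 (fun x => p.[x] <=v q.[x] <-> dv_near0 d p q).
Proof.
elim: d p q => [|d IH] p q sp sq.
  by apply: near0W => x; move: sp sq; rewrite !leqn0 !size_poly_eq0 => /eqP-> /eqP->;
    rewrite dv_refl.
have horner_shift (r : {poly K}) x : r`_0 = 0 -> r.[x] = (drop_poly 1 r).[x] * x.
  move=> r0; rewrite -[in LHS](poly_take_drop 1 r) hornerD hornerM hornerX.
  rewrite (_ : take_poly 1 r = 0) ?horner0 ?add0r //.
  by apply/polyP => -[|i]; rewrite coef_take_poly coef0.
have horner0E (r : {poly K}) x : r.[x] = r`_0 + (r.[x] - r`_0) by rewrite addrC subrK.
have [[p0 q0]|npq] := pselect (p`_0 = 0 /\ q`_0 = 0).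
  have [||dl dl0 hdl] := IH (drop_poly 1 p) (drop_poly 1 q).
  - by rewrite size_drop_poly leq_subLR add1n.
  - by rewrite size_drop_poly leq_subLR add1n.
  exists dl => // x x0 /(hdl _ x0) hx.
  rewrite (horner_shift p) // (horner_shift q) // dvM2r //.
  split=> [h|[[_ h]|[[]]]] //; last exact/hx.
  by left; split=> //; exact/hx.
have hP : dv_near0 d.+1 p q <-> p`_0 <=v q`_0.
  by split=> [[[]|[]]|] //; right.
have [p0|p0] := eqVneq p`_0 0.
  have q0 : q`_0 != 0 by apply: contra_notN npq => /eqP.
  apply: near0_mono (near0_and (near0_horner p q0) (near0_horner q q0)) => x [hp hq].
  apply: iff_trans (iff_sym hP).
  rewrite p0 dv0r (negPf q0) (horner0E q) dvDr //.
  by move: hp; rewrite p0 subr0 => /negPf ->.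
have [q0|q0] := eqVneq q`_0 0.
  apply: near0_mono (near0_and (near0_horner p p0) (near0_horner q p0)) => x [hp hq].
  apply: iff_trans (iff_sym hP).
  rewrite (horner0E p) dvDl // q0 dvr0.
  by split=> // _; move: hq; rewrite q0 subr0; exact: dvNge.
apply: near0_mono (near0_and (near0_horner p p0) (near0_horner q q0)) => x [hp hq].
apply: iff_trans (iff_sym hP).
by rewrite (horner0E p) (horner0E q) dvDl // dvDr.
Qed.

End SmallPerturbation.

Section Near0Elimination.
Variables (K : fieldType) (Gamma : orderedGroupType) (v : valuation K Gamma).

Lemma polyfam_drop n (P : ('I_n -> K) -> {poly K}) m :
  polyfam P -> polyfam (fun e => drop_poly m (P e)).
Proof.
move=> [hP [d hd]]; split=> [k|].
  by apply: polyfun_ext (hP (k + m)%N) => e; rewrite coef_drop_poly.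
by exists d => e; rewrite size_drop_poly (leq_trans (leq_subr _ _)).
Qed.

Lemma qf_dv_near0 n d (P Q : ('I_n -> K) -> {poly K}) :
  polyfam P -> polyfam Q -> qf v (fun e => dv_near0 v d (P e) (Q e)).
Proof.
elim: d P Q => [|d IH] P Q hP hQ /=; first exact: qf_true.
have h0 : qf v (fun e => (P e)`_0 = 0 /\ (Q e)`_0 = 0).
  by apply: qf_and; apply: qf_eq0; [exact: hP.1 | exact: hQ.1].
apply: qf_or; apply: qf_and => //.
- by apply: IH; exact: polyfam_drop.
- exact: qf_not.
- by apply: qf_dv; [exact: hP.1 | exact: hQ.1].
Qed.

(** Every atom has a limiting truth value as variable 0 tends to 0, given by [dv_near0], and taking
    this limit commutes with negation and conjunction. *)
Lemma qf_near0 n (X : ('I_n.+1 -> K) -> Prop) : qf v X ->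
  exists2 Y, qf v Y & forall e, near0 v (fun x => X (env_cons x e) <-> Y e).
Proof.
elim=> [f g /polyfun_coefs[P hP eP] /polyfun_coefs[Q hQ eQ]||].
- have [_ [d hd]] := hP; have [_ [d' hd']] := hQ.
  exists (fun e => dv_near0 v (maxn d d') (P e) (Q e)); first exact: qf_dv_near0.
  move=> e; have [||dl dl0 h] := @dv_near0P _ _ v (maxn d d') (P e) (Q e).
  + by rewrite leq_max hd.
  + by rewrite leq_max hd' orbT.
  by exists dl => // x x0 xd; rewrite eP eQ; exact: h.
- move=> {}X _ [Y hY eY]; exists (fun e => ~ Y e); first exact: qf_not.
  by move=> e; apply: near0_mono (eY e) => x h; split=> nX /h.
move=> {}X X' _ [Y hY eY] _ [Y' hY' eY'].
exists (fun e => Y e /\ Y' e); first exact: qf_and.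
move=> e; apply: near0_mono (near0_and (eY e) (eY' e)) => x [h h'].
by split=> -[/h ? /h' ?].
Qed.

End Near0Elimination.

(** * Roots with a prescribed pattern of comparisons *)

Section RootElimination.
Variables (K : fieldType) (closedK : GRing.closed_field_axiom K).
Variables (Gamma : orderedGroupType) (v : valuation K Gamma).
Local Notation "x <=v y" := (dv v x y) (at level 70).

(* For pairs (a_i, b_i) with all a_i nonzero, a_i divides b_i for all i iff
   prod_i a_i divides all coefficients of the polynomial with coefficients
   b_i prod_(j <> i) a_j. *)
Fixpoint cofactor_poly (s : seq (K * K)) : {poly K} :=
  if s is ab :: s' then
    (ab.2 * \prod_(cd <- s') cd.1)%:P + ab.1 *: ('X * cofactor_poly s')
  else 0.

Lemma size_cofactor_poly s : (size (cofactor_poly s) <= size s)%N.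
Proof.
elim: s => [|ab s IH] /=; first by rewrite size_poly0.
apply: leq_trans (size_polyD _ _) _; rewrite geq_max.
rewrite (leq_trans (size_polyC_leq1 _)) //=.
apply: leq_trans (size_scale_leq _ _) _; apply: leq_trans (size_polyMleq _ _) _.
by rewrite size_polyX.
Qed.

Lemma dv_cofactor_poly s : {in s, forall ab, ab.1 != 0} ->
  all (fun ab => ab.1 <=v ab.2) s <->
  forall k, \prod_(ab <- s) ab.1 <=v (cofactor_poly s)`_k.
Proof.
elim: s => [|[a b] s IH] hs /=.
  by split=> // _ k; rewrite big_nil coef0 dvr0.
have a0 : a != 0 by exact: (hs (a, b) (mem_head _ _)).
have {}hs : {in s, forall ab, ab.1 != 0} by move=> x xs; apply: hs; rewrite inE xs orbT.
have p0 : \prod_(ab <- s) ab.1 != 0.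
  by rewrite prodf_seq_neq0; apply/allP => x xs; rewrite implyTb; exact: hs.
rewrite big_cons /=.
have cE k : (( b * \prod_(cd <- s) cd.1)%:P + a *: ('X * cofactor_poly s))`_k =
   if k is k'.+1 then a * (cofactor_poly s)`_k' else b * \prod_(cd <- s) cd.1.
  by rewrite coefD coefC coefZ coefXM; case: k => [|k] /=; rewrite ?mulr0 ?addr0 ?add0r.
split=> [/andP[ab /(IH hs) h] k|h].
  by rewrite cE; case: k => [|k]; [exact: dvMr | exact: dvMl].
have := h 0%N; rewrite cE dvM2r // => -> /=; apply/(IH hs) => k.
by have := h k.+1; rewrite cE dvM2l.
Qed.

Variables (n : nat) (A : ('I_n -> K) -> Prop) (d : nat).
Variables (P : ('I_n -> K) -> {poly K}) (F G : nat -> ('I_n -> K) -> {poly K}).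
Variable m : nat.
Hypotheses (hP : polyfam P) (hF : forall i, polyfam (F i)) (hG : forall i, polyfam (G i)).
Hypothesis sizeP : forall e, A e -> size (P e) = d.+1.
Hypothesis F_neq0 : forall e r i, A e -> root (P e) r -> (i < m)%N -> (F i e).[r] != 0.

Let values (S : seq nat) e r := [seq ((F i e).[r], (G i e).[r]) | i <- S].
Let prodF S e := \prod_(i <- S) F i e.
(** The cofactor polynomials at all roots r simultaneously: a polynomial in r once the second
    variable is specialized to u. *)
Let cofac u := fix cofac S e := if S is i :: S' then
  G i e * prodF S' e + F i e * (u%:P * cofac S' e) else 0.

Let prodFE S e r : (prodF S e).[r] = \prod_(ab <- values S e r) ab.1.
Proof. by rewrite /prodF horner_prod /values big_map. Qed.

Let cofacE u S e r : (cofac u S e).[r] = (cofactor_poly (values S e r)).[u].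
Proof.
elim: S => [|i S IH] /=; first by rewrite !horner0.
by rewrite !hornerE IH prodFE mulrC.
Qed.

Let polyfam_prodF S : polyfam (prodF S).
Proof.
elim: S => [|i S IH].
  by apply: polyfam_ext (polyfam_cst _ 1) => e; rewrite /prodF big_nil.
by apply: polyfam_ext (polyfam_mul (hF i) IH) => e; rewrite /prodF big_cons.
Qed.

Let polyfam_cofac u S : polyfam (cofac u S).
Proof.
elim: S => [|i S IH] /=; first exact: polyfam_cst.
apply: polyfam_add; first exact: polyfam_mul.
by apply: polyfam_mul => //; apply: polyfam_mul => //; exact: polyfam_cst.
Qed.

Let rts e := poly_roots closedK (P e).

Let P_neq0 e : A e -> P e != 0.
Proof. by move=> /sizeP sP; rewrite -size_poly_gt0 sP. Qed.

Let size_rts e : A e -> size (rts e) = d.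
Proof. by move=> Ae; rewrite size_poly_roots ?P_neq0 // sizeP. Qed.

Let prodF_neq0 S e r :
  all (fun i => i < m)%N S -> A e -> r \in rts e -> (prodF S e).[r] != 0.
Proof.
move=> /allP hS Ae; rewrite mem_poly_roots ?P_neq0 // => hr.
rewrite prodFE big_map prodf_seq_neq0; apply/allP => i /hS im.
by rewrite implyTb /=; exact: F_neq0.
Qed.

Let holds_at i e r := (F i e).[r] <=v (G i e).[r].

Let qf_count_ge u S k : all (fun i => i < m)%N S ->
  qf_on v A (fun e => (k <= count (fun r => (prodF S e).[r] <=v (cofac u S e).[r]) (rts e))%N).
Proof.
move=> hS; pose bad e := count (fun r => ~~ ((prodF S e).[r] <=v (cofac u S e).[r])) (rts e).
have h : qf_on v A (fun e => exists j : 'I_d.+1, bad e = j /\ (k + j <= d)%N).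
  apply: qf_on_exists => j; apply: qf_on_and; last by apply: qf_onW; exact: qf_cst.
  apply: qf_count_atom sizeP _ => // e r Ae hr.
  by rewrite prodF_neq0 // mem_poly_roots ?P_neq0.
apply: qf_on_ext h => e Ae.
have eqc : (count (fun r => (prodF S e).[r] <=v (cofac u S e).[r]) (rts e) + bad e = d)%N.
  by rewrite /bad count_predC size_rts.
have bd : (bad e < d.+1)%N by rewrite ltnS -[X in (_ <= X)%N]eqc leq_addl.
split=> [[j [hj hk]]|hk]; first by rewrite -(leq_add2r (bad e)) eqc hj.
by exists (Ordinal bd); split=> //=; rewrite -[X in (_ <= X)%N]eqc leq_add2r.
Qed.

(* The number of roots satisfying all conditions in [S] is the minimum, over
   sufficiently many residues [u], of a number of roots satisfying a single
   condition. *)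
Let qf_count_all S k : all (fun i => i < m)%N S ->
  qf_on v A (fun e => count (fun r => all (fun i => holds_at i e r) S) (rts e) = k).
Proof.
move=> hS.
(* There is one cofactor polynomial for each of the d roots, and each excludes at most [size S]
   residues. *)
have [us hus sus] := exists_residue_list closedK v (d * size S).+1.
pose cnt u e := count (fun r => (prodF S e).[r] <=v (cofac u S e).[r]) (rts e).
have holdsP e r : A e -> r \in rts e ->
    all (fun i => holds_at i e r) S <->
    forall k, (prodF S e).[r] <=v (cofactor_poly (values S e r))`_k.
  move=> Ae hr; rewrite prodFE -dv_cofactor_poly ?all_map //.
  move=> ab /mapP[i iS ->] /=; move: hr; rewrite mem_poly_roots ?P_neq0 // => hr.
  by apply: F_neq0 => //; exact: (allP hS).
have ge_count j : qf_on v A (fun e =>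
    (j <= count (fun r => all (fun i => holds_at i e r) S) (rts e))%N).
  have h : qf_on v A (fun e => forall t : 'I_(size us), (j <= cnt (nth 0%R us t) e)%N).
    by apply: qf_on_forall => t; exact: qf_count_ge.
  apply: qf_on_ext h => e Ae; split=> [h|h t].
    have [u uus gu] : exists2 u, u \in us & forall p,
        p \in [seq cofactor_poly (values S e r) | r <- rts e] -> gauss_generic v p u.
      apply: (exists_gauss_generic closedK hus); rewrite sus ltnS big_map.
      rewrite -(size_rts Ae) -(count_predT (rts e)) -sum1_count big_distrl /=.
      apply: leq_sum => r _; rewrite mul1n; apply: leq_trans (leq_pred _) _.
      by apply: leq_trans (size_cofactor_poly _) _; rewrite size_map.
    apply: leq_trans (h (Ordinal (etrans (index_mem u us) uus))) _.
    rewrite /cnt /= nth_index //.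
    rewrite leq_eqVlt; apply/orP; left; apply/eqP; apply: eq_in_count => r hr /=.
    apply/idP/idP => hd; last first.
      rewrite cofacE; apply: dv_horner; last exact/holdsP.
      by have /andP[/allP h1 _] := hus; exact: h1.
    apply/holdsP => // i; apply: dv_trans hd _; rewrite cofacE; apply: gu.
    exact: map_f.
  have uus : 1 <=v nth 0 us t by have /andP[/allP h1 _] := hus; exact/h1/mem_nth.
  apply: leq_trans h _; rewrite /cnt.
  set a := (X in (count X _ <= _)%N); set b := (X in (_ <= count X _)%N).
  rewrite (@eq_in_count _ a (predI a b)) => [|r hr]; first by apply: sub_count => x /andP[].
  rewrite /= andb_idr // /a => /(holdsP _ _ Ae hr) h1.
  by rewrite /b cofacE; exact: dv_horner.
apply: qf_on_ext (qf_on_and (ge_count k) (qf_on_not (ge_count k.+1))) => e Ae.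
split=> [[h /negP]|->]; last by split=> //; apply/negP; rewrite ltnn.
by rewrite -leqNgt => h'; apply/eqP; rewrite eqn_leq h' h.
Qed.

(** Negated conditions are removed one at a time: the roots satisfying S but not i are those
    satisfying S minus those satisfying i together with S. *)
Let qf_count_pattern S T k : all (fun i => i < m)%N S -> all (fun i => i < m)%N T ->
  qf_on v A (fun e => count (fun r => all (fun i => holds_at i e r) S &&
                                   all (fun i => ~~ holds_at i e r) T) (rts e) = k).
Proof.
elim: T S k => [|i T IH] S k hS /=.
  by move=> _; apply: qf_on_ext (qf_count_all k hS) => e _;
    under [in X in _ <-> X]eq_count do rewrite andbT.
move=> /andP[im hT].
pose cnt S' e := count (fun r => all (fun i => holds_at i e r) S' &&
                                 all (fun i => ~~ holds_at i e r) T) (rts e).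
have h : qf_on v A (fun e => exists j : 'I_d.+1, cnt (i :: S) e = j /\ cnt S e = (k + j)%N).
  by apply: qf_on_exists => j; apply: qf_on_and; apply: IH => //=; rewrite im.
apply: qf_on_ext h => e Ae.
set cnt' := count _ _.
have eqc : (cnt' + cnt (i :: S) e = cnt S e)%N.
  rewrite /cnt /cnt' addnC -count_predUI addnC.
  rewrite (@eq_count _ (predI _ _) pred0) ?count_pred0 => [|r /=]; last first.
    by case: (holds_at i e r); rewrite ?andbF.
  by rewrite add0n; apply: eq_count => r /=; case: (holds_at i e r); rewrite /= ?andbF ?orbF.
have bd : (cnt (i :: S) e < d.+1)%N by rewrite ltnS -[X in (_ <= X)%N](size_rts Ae) count_size.
split=> [[j [hj hk]]|hk]; last by exists (Ordinal bd); rewrite -eqc hk.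
by move: eqc; rewrite hj hk => /addIn.
Qed.

Lemma qf_on_exists_root (b : 'I_m -> bool) :
  qf_on v A (fun e => exists2 r, root (P e) r &
    forall i : 'I_m, ((F i e).[r] <=v (G i e).[r]) = b i).
Proof.
pose S c := [seq val i | i <- enum 'I_m & b i == c].
have hS c : all (fun i => i < m)%N (S c) by apply/allP => j /mapP[i _ ->] /=; exact: ltn_ord.
apply: qf_on_ext (qf_on_not (qf_count_pattern 0 (hS true) (hS false))) => e Ae.
split=> [|[r hr hb] /eqP].
  move/eqP; rewrite -lt0n -has_count => /hasP[r]; rewrite mem_poly_roots ?P_neq0 // => hr.
  move=> /andP[/allP h1 /allP h2]; exists r => // i.
  have hi c : b i = c -> val i \in S c.
    by move=> bc; apply/map_f; rewrite mem_filter bc eqxx mem_enum.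
  case E : (b i); first exact: (h1 _ (hi _ E)).
  exact: negbTE (h2 _ (hi _ E)).
apply/negP; rewrite -lt0n -has_count; apply/hasP; exists r.
  by rewrite mem_poly_roots ?P_neq0.
by apply/andP; split; apply/allP => _ /mapP[i +  ->]; rewrite mem_filter /holds_at hb => /andP[/eqP->].
Qed.

End RootElimination.

Lemma total_preorder_max (T : eqType) (R : rel T) (s : seq T) x :
  total R -> transitive R -> x \in s -> exists2 m, m \in s & {in s, forall y, R y m}.
Proof.
move=> tR trR; elim: s x => // y [|z s] IH x _.
  exists y; rewrite ?mem_head // => w; rewrite inE => /eqP->.
  by have := tR y y; rewrite orbb.
have [m ms hm] := IH z (mem_head _ _).
have /orP[ym|my] := tR y m.
  exists m; first by rewrite inE ms orbT.
  by move=> w; rewrite inE => /orP[/eqP->|/hm].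
exists y; first exact: mem_head.
move=> w; rewrite inE => /orP[/eqP->|/hm wm]; last exact: trR my.
by have := tR y y; rewrite orbb.
Qed.

Lemma total_preorder_fin_max (T : finType) (U : Type) (R : rel U) (f : T -> U)
    (Q : pred T) t : total R -> transitive R -> Q t ->
  exists2 m, Q m & forall t', Q t' -> R (f t') (f m).
Proof.
move=> tR trR Qt.
have [|||m ms hm] := @total_preorder_max T (relpre f R) (enum Q) t.
- by move=> a b; exact: tR.
- by move=> a b c; exact: trR.
- by rewrite mem_enum.
exists m; first by rewrite mem_enum in ms.
by move=> t' Qt'; apply: hm; rewrite mem_enum.
Qed.

(** * Quantifier elimination *)

Section ExistentialElimination.
Variables (K : fieldType) (closedK : GRing.closed_field_axiom K).
Variables (Gamma : orderedGroupType) (v : valuation K Gamma).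
Local Notation "x <=v y" := (dv v x y) (at level 70).

(** The Boolean combination [B] acts on sequences indexed by nat, of which only the first m entries
    matter, so that the atoms of a conjunction can be concatenated by shifting indices. *)
Lemma qf_normal_form n (X : ('I_n.+1 -> K) -> Prop) : qf v X ->
  exists m (F G : nat -> ('I_n -> K) -> {poly K}) (B : (nat -> bool) -> Prop),
  [/\ (forall i, polyfam (F i)), (forall i, polyfam (G i)),
      (forall b b', (forall i, (i < m)%N -> b i = b' i) -> B b -> B b') &
      forall e r, X (env_cons r e) <-> B (fun i => (F i e).[r] <=v (G i e).[r])].
Proof.
elim=> [f g /polyfun_coefs[P hP eP] /polyfun_coefs[Q hQ eQ]||].
- exists 1%N, (fun=> P), (fun=> Q), (fun b => b 0%N); split=> //.
    by move=> b b' ->.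
  by move=> e r; rewrite eP eQ.
- move=> {}X _ [m [F [G [B [hF hG hB eB]]]]]; exists m, F, G, (fun b => ~ B b).
  split=> // [b b' bb' nB /hB|e r]; last by split=> nB /eB.
  by move=> /(_ b) h; apply: nB; apply: h => i im; rewrite bb'.
move=> {}X Y _ [m [F [G [B [hF hG hB eB]]]]] _ [m' [F' [G' [B' [hF' hG' hB' eB']]]]].
exists (m + m')%N, (fun i => if (i < m)%N then F i else F' (i - m)%N),
  (fun i => if (i < m)%N then G i else G' (i - m)%N),
  (fun b => B (fun i => b i) /\ B' (fun i => b (m + i)%N)); split.
- by move=> i; case: ifP.
- by move=> i; case: ifP.
- move=> b b' bb' [h h']; split; first by apply: hB h => i im; apply: bb'; exact: ltn_addr.
  by apply: hB' h' => i im; apply: bb'; rewrite ltn_add2l.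
move=> e r; rewrite eB eB'.
have e' : (fun i => (F' i e).[r] <=v (G' i e).[r]) =
    (fun i => ((if (m + i < m)%N then F (m + i)%N else F' (m + i - m)%N) e).[r] <=v
      ((if (m + i < m)%N then G (m + i)%N else G' (m + i - m)%N) e).[r]).
  by apply/funext => i; rewrite ltnNge leq_addr addKn.
by rewrite -e'; split=> -[h h']; split=> //; apply: hB h => i im; rewrite im.
Qed.

Lemma qf_exists_root n (P : ('I_n -> K) -> {poly K}) (X : ('I_n.+1 -> K) -> Prop) :
  polyfam P -> qf v X ->
  qf v (fun e => P e != 0 /\ exists2 r, root (P e) r & X (env_cons r e)).
Proof.
move=> hP /qf_normal_form[m [F [G [B [hF hG hB eB]]]]].
have [_ [D hD]] := hP.
pose ext (b : {ffun 'I_m -> bool}) (i : nat) : bool := oapp b false (insub i).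
have extE b (i : 'I_m) : ext b i = b i by rewrite /ext valK.
have extB (b : {ffun _}) (c : nat -> bool) : (forall i : 'I_m, c i = b i) -> B c <-> B (ext b).
  by move=> h; split; apply: hB => i im; rewrite -[i]/(val (Ordinal im)) extE h.
(* [good d] expresses for d < D that [P e] has degree d, without quantifiers; the counting of roots
   is available only for a fixed degree. *)
pose good d e := (P e)`_d != 0 /\ forall j : 'I_D, (d < j)%N -> (P e)`_j = 0.
have goodP d e : (d < D)%N -> good d e <-> size (P e) = d.+1.
  move=> dD; split=> [[h0 hj]|sP].
    apply/eqP; rewrite eqn_leq; apply/andP; split.
      apply/leq_sizeP => j dj; have [jD|Dj] := ltnP j D.
        exact: (hj (Ordinal jD)).
      by rewrite nth_default // (leq_trans (hD e)).
    by rewrite ltnNge; apply: contra h0 => h0; rewrite nth_default.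
  split; first by rewrite -[d]/(d.+1.-1) -sP -lead_coefE lead_coef_eq0 -size_poly_gt0 sP.
  by move=> j dj; rewrite nth_default // sP.
have qf_good d : qf v (good d).
  apply: qf_and.
    apply: qf_ext (qf_not (qf_eq0 v (hP.1 d))) => e.
    by split=> [/eqP|/eqP].
  apply: qf_forall => j; have [dj|_] := boolP (d < j)%N.
    by apply: qf_ext (qf_eq0 v (hP.1 j)) => e; split=> [|/(_ isT)].
  by apply: qf_ext (qf_true v n) => e.
have main d (b : {ffun 'I_m -> bool}) : qf_on v (fun e => size (P e) = d.+1)
    (fun e => exists2 r, root (P e) r &
      forall i : 'I_m, ((F i e).[r] <=v (G i e).[r]) = b i).
  pose P' (e : 'I_n.+1 -> K) := P (env_tail e).
  (* A new variable 0 is added to both sides of every comparison. For small nonzero values it makes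
     the left sides nonzero at all roots and changes no comparison there; [qf_near0] then disposes
     of it. *)
  pose F' i (e : 'I_n.+1 -> K) := F i (env_tail e) + (e ord0)%:P.
  pose G' i (e : 'I_n.+1 -> K) := G i (env_tail e) + (e ord0)%:P.
  pose A e := size (P' e) = d.+1 /\
     forall r (i : 'I_m), root (P' e) r -> (F' i e).[r] != 0.
  have hC : polyfam (fun e : 'I_n.+1 -> K => (e ord0)%:P).
    by apply: polyfam_polyC; exact: polyfun_var.
  have hP' : polyfam P' by exact: polyfam_tail.
  have hF' i : polyfam (F' i) by apply: polyfam_add => //; exact: polyfam_tail.
  have hG' i : polyfam (G' i) by apply: polyfam_add => //; exact: polyfam_tail.
  have [||Y hY eY] := @qf_on_exists_root _ closedK _ v _ A d P' F' G' m hP' hF' hG' _ _ b.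
  - by move=> e [].
  - by move=> e r i [_ h] hr im; exact: (h r (Ordinal im)).
  have [Z hZ eZ] := qf_near0 hY.
  exists Z => // e sP.
  have P0 : P e != 0 by rewrite -size_poly_gt0 sP.
  have h1 : near0 v (fun x => forall r, r \in poly_roots closedK (P e) ->
      forall i, i \in enum 'I_m -> (F i e).[r] + x != 0 /\
        ((F i e).[r] + x <=v (G i e).[r] + x) = ((F i e).[r] <=v (G i e).[r])).
    by apply: near0_all => r _; apply: near0_all => i _; exact: near0_perturb.
  have [x x0 [hx hZx]] := near0_ex (near0_and h1 (eZ e)).
  have Ax : A (env_cons x e).
    split; rewrite /P' ?env_consK // => r i hr.
    rewrite /F' env_consK env_cons0 hornerD hornerC.
    by apply: (proj1 (hx r _ i _)); rewrite ?mem_enum ?mem_poly_roots.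
  apply: iff_trans (iff_sym hZx) _; apply: iff_trans (eY _ Ax) _.
  have hcmp r (i : 'I_m) : root (P e) r ->
     ((F' i (env_cons x e)).[r] <=v (G' i (env_cons x e)).[r]) =
     ((F i e).[r] <=v (G i e).[r]).
    move=> hr; rewrite /F' /G' env_consK env_cons0 !hornerD !hornerC.
    by apply: (proj2 (hx r _ i _)); rewrite ?mem_enum ?mem_poly_roots.
  rewrite /P' env_consK.
  by split=> -[r hr h]; exists r => // i; [rewrite -hcmp | rewrite hcmp].
have /choice[Y hY] : forall db : 'I_D * {ffun 'I_m -> bool}, exists Y, qf v Y /\
    forall e, size (P e) = db.1.+1 -> (Y e <-> exists2 r, root (P e) r &
      forall i : 'I_m, ((F i e).[r] <=v (G i e).[r]) = db.2 i).
  by move=> [d b]; have [Y ? ?] := main d b; exists Y.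
have h : qf v (fun e => exists db : 'I_D * {ffun 'I_m -> bool},
    good db.1 e /\ B (ext db.2) /\ Y db e).
  apply: qf_exists => db; apply: qf_and => //; apply: qf_and; first exact: qf_cst.
  exact: (hY db).1.
apply: qf_ext h => e; split=> [[[d b] [/= /goodP-/(_ (ltn_ord d)) sP [hb]]]|[P0 [r hr hX]]].
  move=> /((hY (d, b)).2 e sP)[r hr h]; split; first by rewrite -size_poly_gt0 sP.
  by exists r => //; apply/eB/extB; last exact: hb.
have dD : ((size (P e)).-1 < D)%N.
  by apply: leq_trans (hD e); rewrite prednK // size_poly_gt0.
have sP : size (P e) = (Ordinal dD).+1 by rewrite /= prednK // size_poly_gt0.
exists (Ordinal dD, [ffun i : 'I_m => (F i e).[r] <=v (G i e).[r]]).
split; first exact/goodP.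
split; first by move/eB: hX; apply: (extB _ _ _).1 => i; rewrite ffunE.
by apply/(hY _).2 => //; exists r => // i; rewrite ffunE.
Qed.

(** * Test values for a valuation *)

Section TestPoints.
Variables (C : finType) (A B : C -> K) (N : C -> nat) (th : K).

Definition test_index : finType := option (C * bool + C * C)%type.

(** Let s_c be a solution of A_c s^(N_c) = B_c. Up to roots of unity, the solutions t of lhs t^exp =
    rhs are 1, s_c th, s_c / th and a square root of s_c s_c'. They are described by equations
    because s_c is not a polynomial function of the coefficients. *)
Definition test_lhs (j : test_index) : K :=
  match j with
  | None => 1
  | Some (inl (c, true)) => A c
  | Some (inl (c, false)) => A c * th ^+ N c
  | Some (inr (c, c')) => A c ^+ N c' * A c' ^+ N c
  end.

Definition test_rhs (j : test_index) : K :=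
  match j with
  | None => 1
  | Some (inl (c, true)) => B c * th ^+ N c
  | Some (inl (c, false)) => B c
  | Some (inr (c, c')) => B c ^+ N c' * B c' ^+ N c
  end.

Definition test_exp (j : test_index) : nat :=
  match j with
  | None => 1
  | Some (inl (c, _)) => N c
  | Some (inr (c, c')) => (N c * N c').*2
  end.

Lemma exists_nth_root x k : (0 < k)%N -> exists y : K, y ^+ k = x.
Proof.
move=> k0; have [y] := closedK (fun i => if i == 0%N then x else 0) k0.
case: k k0 => // k _ hy; exists y.
by rewrite hy big_ord_recl /= expr0 mulr1 big1 ?addr0 // => i _; rewrite mul0r.
Qed.

(* Between two consecutive critical valuations a geometric mean is a test point;
   beyond the extreme ones, multiply or divide by [th]. *)
Lemma exists_test_point t0 : th != 0 -> ~~ (th <=v 1) -> t0 != 0 ->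
  exists t, exists j, [/\ t != 0, test_lhs j != 0, (0 < test_exp j)%N,
    test_lhs j * t ^+ test_exp j = test_rhs j &
    forall c, A c != 0 -> B c != 0 -> (0 < N c)%N ->
      (A c * t ^+ N c <=v B c) = (A c * t0 ^+ N c <=v B c) /\
      (B c <=v A c * t ^+ N c) = (B c <=v A c * t0 ^+ N c)].
Proof.
move=> th0 th1 t00.
pose valid c := [&& A c != 0, B c != 0 & (0 < N c)%N].
have /choice[s hs] : forall c, exists s, valid c -> A c * s ^+ N c = B c.
  move=> c; have [/and3P[A0 _ N0]|] := boolP (valid c); last by exists 0.
  by have [s hs] := exists_nth_root (B c / A c) N0; exists s => _; rewrite hs mulrC divfK.
have s0 c : valid c -> s c != 0.
  move=> vc; have /and3P[_ B0 N0] := vc; apply: contraNneq B0 => sc.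
  by rewrite -(hs c vc) sc expr0n eqn0Ngt N0 mulr0.
suff [t [j [h0 h1 h2 h3 h4]]] : exists t, exists j, [/\ t != 0, test_lhs j != 0,
    (0 < test_exp j)%N, test_lhs j * t ^+ test_exp j = test_rhs j &
    forall c, valid c -> (t <=v s c) = (t0 <=v s c) /\ (s c <=v t) = (s c <=v t0)].
  exists t, j; split=> // c A0 B0 N0; have vc : valid c by apply/and3P.
  by rewrite -{1 2 3 4}(hs c vc) !dvM2l // !dvX2 //; exact: h4.
have tot := dv_total v.
have trans : transitive (dv v) by move=> y x z; exact: dv_trans.
have ftot : total (fun x y => dv v y x) by move=> x y; exact: tot.
have ftrans : transitive (fun x y => dv v y x) by move=> y x z h1 h2; exact: dv_trans h2 h1.
have [/existsP[cl hl]|/existsPn nol] := boolP [exists c, valid c && (s c <=v t0)];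
have [/existsP[cu hu]|/existsPn nou] := boolP [exists c, valid c && (t0 <=v s c)].
- have [c1 /andP[v1 h1] m1] := total_preorder_fin_max (Q := fun c => valid c && (s c <=v t0)) s tot trans hl.
  have [c2 /andP[v2 h2] m2] := total_preorder_fin_max (Q := fun c => valid c && (t0 <=v s c)) s ftot ftrans hu.
  have [t ht] := exists_nth_root (s c1 * s c2) (isT : (0 < 2)%N).
  have t_neq0 : t != 0.
    have : t ^+ 2 != 0 by rewrite ht mulf_neq0 ?s0.
    by rewrite expf_eq0.
  have s12 := dv_trans h1 h2.
  have s1t : s c1 <=v t by rewrite -(@dvX2 _ _ v 2) // ht expr2 dvM2l ?s0.
  have ts2 : t <=v s c2 by rewrite -(@dvX2 _ _ v 2) // ht expr2 dvM2r ?s0.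
  (* If the geometric mean ties with one of the two ends, the ends have equal valuation, so t0
     between them ties as well. *)
  have ts1 : t <=v s c1 -> s c2 <=v s c1.
    by rewrite -(@dvX2 _ _ v 2) // ht expr2 dvM2l ?s0.
  have s2t : s c2 <=v t -> s c2 <=v s c1.
    by rewrite -(@dvX2 _ _ v 2) // ht expr2 dvM2r ?s0.
  have /and3P[A1 B1 N1] := v1; have /and3P[A2 B2 N2] := v2.
  exists t, (Some (inr (c1, c2))); split=> //=.
  + by rewrite mulf_neq0 // expf_neq0.
  + by rewrite double_gt0 muln_gt0 N1.
  + rewrite -mul2n exprM ht exprMn -(hs _ v1) -(hs _ v2) !exprMn -!exprM.
    by rewrite [(N c2 * N c1)%N]mulnC mulrACA.
  move=> c vc; have lo (h : s c <=v t0) : s c <=v s c1 by apply: (m1 c); rewrite vc.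
  have up (h : t0 <=v s c) : s c2 <=v s c by apply: (m2 c); rewrite vc.
  have [h|h] := boolP (s c <=v t0); have [h'|h'] := boolP (t0 <=v s c).
  + by rewrite (dv_trans ts2 (up h')) (dv_trans (lo h) s1t).
  + rewrite (dv_trans (lo h) s1t); split=> //; apply/negP => tc; case/negP: h'.
    exact: dv_trans h2 (dv_trans (ts1 (dv_trans tc (lo h))) (dv_trans s1t tc)).
  + rewrite (dv_trans ts2 (up h')); split=> //; apply/negP => ct; case/negP: h.
    exact: dv_trans ct (dv_trans ts2 (dv_trans (s2t (dv_trans (up h') ct)) h1)).
  + by have := tot (s c) t0; rewrite (negPf h) (negPf h').
- have [c1 /andP[v1 h1] m1] := total_preorder_fin_max (Q := fun c => valid c && (s c <=v t0)) s tot trans hl.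
  have /and3P[A1 B1 N1] := v1.
  exists (s c1 * th), (Some (inl (c1, true))); split=> //=.
  + by rewrite mulf_neq0 ?s0.
  + by rewrite exprMn mulrA hs.
  move=> c vc; have := nou c; rewrite vc /= => h'; have h := dvNge h'.
  rewrite h (negPf h').
  have cc1 : s c <=v s c1 by apply: m1; rewrite vc.
  split; first apply/negP => hc.
    case/negP: th1; rewrite -(dvM2l v _ _ (s0 _ v1)) mulr1; exact: dv_trans hc cc1.
  apply: dv_trans cc1 _; rewrite -{1}[s c1]mulr1; apply: dvMl; exact: dvNge.
- have [c2 /andP[v2 h2] m2] := total_preorder_fin_max (Q := fun c => valid c && (t0 <=v s c)) s ftot ftrans hu.
  have /and3P[A2 B2 N2] := v2.
  exists (s c2 / th), (Some (inl (c2, false))); split=> //=.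
  + by rewrite mulf_neq0 ?invr_eq0 ?s0.
  + by rewrite mulf_neq0 // expf_neq0.
  + by rewrite -mulrA -exprMn [th * _]mulrC divfK // hs.
  move=> c vc; have := nol c; rewrite vc /= => h'; have h := dvNge h'.
  rewrite h (negPf h').
  have cc2 : s c2 <=v s c by apply: (m2 c); rewrite vc.
  split; last first.
    apply/negP => hc; case/negP: th1.
    rewrite -(dvM2l v _ _ (s0 _ v2)) mulr1 -(dvM2r v _ _ (_ : th^-1 != 0)) ?invr_eq0 //.
    rewrite mulfK //; exact: dv_trans cc2 hc.
  apply: dv_trans _ cc2; rewrite -(dvM2r v _ _ th0) divfK //.
  by rewrite -{1}[s c2]mulr1; apply: dvMl; exact: dvNge.
- exists 1, None; rewrite /= oner_neq0 mulr1; split=> // c vc.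
  by have := tot (s c) t0; have := nol c; have := nou c; rewrite vc /= => /negPf-> /negPf->.
Qed.

End TestPoints.

End ExistentialElimination.

Definition dilate (K : fieldType) (p : {poly K}) (t : K) : {poly K} :=
  \poly_(k < size p) (p`_k * t ^+ k).

Section QuantifierElimination.
Variables (K : fieldType) (closedK : GRing.closed_field_axiom K).
Variables (Gamma : orderedGroupType) (v : valuation K Gamma).
Local Notation "x <=v y" := (dv v x y) (at level 70).

Lemma coef_dilate (p : {poly K}) t k : (dilate p t)`_k = p`_k * t ^+ k.
Proof.
by rewrite coef_poly; case: ltnP => // pk; rewrite nth_default // mul0r.
Qed.

Lemma size_dilate (p : {poly K}) t : (size (dilate p t) <= size p)%N.
Proof. exact: size_poly. Qed.

Lemma horner_dilate (p : {poly K}) t u : (dilate p t).[u] = p.[t * u].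
Proof.
rewrite (horner_coef_wide _ (size_dilate p t)) horner_coef; apply: eq_bigr => k _.
by rewrite coef_dilate exprMn mulrA.
Qed.

(** Cancelling the lower power of t leaves one of the critical comparisons, with a positive
    exponent, or no t at all. *)
Lemma dv_dilate_coef (a b t t0 : K) k l : t != 0 -> t0 != 0 ->
  ((l < k)%N -> a != 0 -> b != 0 ->
     (a * t ^+ (k - l) <=v b) = (a * t0 ^+ (k - l) <=v b)) ->
  ((k < l)%N -> b != 0 -> a != 0 ->
     (a <=v b * t ^+ (l - k)) = (a <=v b * t0 ^+ (l - k))) ->
  (a * t ^+ k <=v b * t ^+ l) = (a * t0 ^+ k <=v b * t0 ^+ l).
Proof.
move=> tn0 t0n0 h1 h2.
have [->|b0] := eqVneq b 0; first by rewrite !mul0r !dvr0.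
have [->|a0] := eqVneq a 0.
  by rewrite !mul0r !dv0r !mulf_eq0 !expf_eq0 (negPf tn0) (negPf t0n0) !andbF.
have [kl|lk|->] := ltngtP k l.
- rewrite -(subnK (ltnW kl)) !exprD !mulrA !dvM2r ?expf_neq0 //; exact: h2.
- rewrite -(subnK (ltnW lk)) !exprD !mulrA !dvM2r ?expf_neq0 //; exact: h1.
- by rewrite !dvM2r ?expf_neq0.
Qed.

Section Translates.
Variables (n : nat) (T : finType) (H : T -> ('I_n -> K) -> {poly K}).
Variable H' : T -> ('I_n.+1 -> K) -> {poly K}.
Variable D : nat.
Hypothesis eH' : forall t y r e, (H' t (env_cons r e)).[y] = (H t e).[r + y].
Hypothesis sH' : forall t e, (size (H' t e) <= D)%N.
Variable th : K.
Hypotheses (th0 : th != 0) (th1 : ~~ (th <=v 1)).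
Variable us : seq K.
Hypotheses (hus : residue_list v us) (sus : (#|T| * D < size us)%N).

(** The critical valuations of s are those where a monomial of index k of one Taylor expansion ties
    with one of index l of another. The subtraction [crit_exp] is truncated: pairs with k <= l get
    exponent 0, which the test points disregard. *)
Definition crit_index : finType := ((T * 'I_D) * (T * 'I_D))%type.
Definition crit_lhs e (c : crit_index) : K := (H' c.1.1 e)`_c.1.2.
Definition crit_rhs e (c : crit_index) : K := (H' c.2.1 e)`_c.2.2.
Definition crit_exp (c : crit_index) : nat := (c.1.2 - c.2.2)%N.
(** The extra candidate 'X, with root 0, ensures that a closest root exists even if no polynomial of
    the family has one to offer. *)
Definition root_candidate (q : option T) e : {poly K} := if q is Some t then H t e else 'X.

(* For [r] a candidate root closest to [y], the residue 1 is generic for all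
   polynomials [H t e (r + (y - r) Z)] in [Z]. *)
Lemma exists_equivalent_test_point e y :
  exists q r, [/\ root_candidate q e != 0, root (root_candidate q e) r &
   y = r \/ exists j s, exists2 u, u \in us &
   [/\ test_lhs (crit_lhs (env_cons r e)) crit_exp th j != 0,
     (0 < test_exp crit_exp j)%N,
     test_lhs (crit_lhs (env_cons r e)) crit_exp th j * s ^+ test_exp crit_exp j =
       test_rhs (crit_rhs (env_cons r e)) crit_exp th j &
     forall t t', ((H t e).[r + s * u] <=v (H t' e).[r + s * u]) =
                  ((H t e).[y] <=v (H t' e).[y])]].
Proof.
pose cand := 0 :: flatten [seq poly_roots closedK (H t e) | t <- enum T & H t e != 0].
have candP s : s \in cand -> exists q, root_candidate q e != 0 /\ root (root_candidate q e) s.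
  rewrite inE => /orP[/eqP->|]; first by exists None; rewrite /= polyX_eq0 rootX.
  move=> /flatten_mapP[t]; rewrite mem_filter => /andP[t0 _].
  by rewrite mem_poly_roots // => hs; exists (Some t).
have mem_cand t s : H t e != 0 -> root (H t e) s -> s \in cand.
  move=> t0 hs; rewrite inE; apply/orP; right; apply/flatten_mapP.
  by exists t; [rewrite mem_filter t0 mem_enum | rewrite mem_poly_roots].
have [||r rc hr] := @total_preorder_max _ (fun a b => (y - a) <=v (y - b)) cand 0 _ _ (mem_head _ _).
- by move=> a b; exact: dv_total.
- by move=> a b c; exact: dv_trans.
have [q [q0 hq]] := candP r rc.
exists q, r; split=> //; have [->|yr] := eqVneq y r; [by left | right].
pose p t := H' t (env_cons r e).
have s0_neq0 : y - r != 0 by rewrite subr_eq0.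
have [s [j [s0 hl he hlr hcmp]]] := exists_test_point closedK (crit_lhs (env_cons r e))
  (crit_rhs (env_cons r e)) crit_exp th0 th1 s0_neq0.
have coef_cmp t t' (k l : 'I_D) : ((p t)`_k * s ^+ k <=v (p t')`_l * s ^+ l) =
    ((p t)`_k * (y - r) ^+ k <=v (p t')`_l * (y - r) ^+ l).
  apply: dv_dilate_coef => // kl a0 b0.
    by apply: (hcmp ((t, k), (t', l)) _ _ _).1 => //; rewrite /crit_exp /= subn_gt0.
  by apply: (hcmp ((t', l), (t, k)) _ _ _).2 => //; rewrite /crit_exp /= subn_gt0.
have sp t w : (size (dilate (p t) w) <= D)%N := leq_trans (size_dilate _ _) (sH' _ _).
have [u uus gu] : exists2 u, u \in us &
    forall g, g \in [seq dilate (p t) s | t <- enum T] -> gauss_generic v g u.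
  apply: (exists_gauss_generic closedK hus); apply: leq_ltn_trans sus; rewrite big_map.
  rewrite cardE -(count_predT (enum T)) -sum1_count big_distrl /=.
  by apply: leq_sum => t _; rewrite mul1n; apply: leq_trans (leq_pred _) _; exact: sp.
have g1 t : gauss_generic v (dilate (p t) (y - r)) 1.
  have [t0|t0] := eqVneq (H t e) 0.
    have -> : dilate (p t) (y - r) = 0.
      by apply: (poly_eq_horner closedK) => a; rewrite horner_dilate eH' t0 !horner0.
    by move=> k; rewrite horner0 coef0 dv_refl.
  apply: (gauss_generic_roots closedK) => [|z]; first exact: dv_refl.
  rewrite /root horner_dilate eH' => hz.
  (* A root z of the dilated polynomial gives the root r + (y - r) z of [H t e], whose difference
     from y is (y - r)(1 - z). As r is closest to y, 1 - z has valuation at most 0. *)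
  have := hr _ (mem_cand t _ t0 hz).
  rewrite -[X in _ <=v X]mulr1 opprD addrA -{1}[y - r]mulr1 -mulrBr.
  by rewrite dvM2l.
exists j, s, u => //; split=> // t t'.
have u1 : 1 <=v u by have /andP[/allP h _] := hus; exact: h.
have gs t1 : gauss_generic v (dilate (p t1) s) u by apply: gu; apply: map_f; rewrite mem_enum.
have e1 t1 : (H t1 e).[r + s * u] = (dilate (p t1) s).[u] by rewrite horner_dilate eH'.
have e2 t1 : (H t1 e).[y] = (dilate (p t1) (y - r)).[1].
  by rewrite horner_dilate eH' mulr1 addrC subrK.
rewrite !e1 !e2 !(@gauss_generic_cmp _ _ v _ _ _ _ D) ?u1 ?dv_refl //.
by apply: eq_forallb => l; apply: eq_existsb => k; rewrite !coef_dilate.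
Qed.

End Translates.

Theorem qf_exists_env n (X : ('I_n.+1 -> K) -> Prop) :
  qf v X -> qf v (fun e => exists a, X (env_cons a e)).
Proof.
move=> hX; have [m [F [G [B [hF hG hB eB]]]]] := qf_normal_form hX.
pose H (t : bool * 'I_m) := if t.1 then F t.2 else G t.2.
have hH t : polyfam (H t) by rewrite /H; case: t.1.
have tail_var k (i : 'I_k) : polyfun (fun e : 'I_k.+1 -> K => env_tail e i).
  exact: polyfun_var.
(* [H' t] is the Taylor expansion of [H t] at r: its coefficients are polynomial functions of r and
   e. *)
have /choice[H' hH'] : forall t, exists P, polyfam P /\
    forall r e y, (P (env_cons r e)).[y] = (H t e).[r + y].
  move=> t.
  have hf : polyfun (fun e : 'I_n.+2 -> K =>
      (H t (env_tail (env_tail e))).[env_tail e ord0 + e ord0]).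
    apply: (@polyfun_horner _ _ (fun e : 'I_n.+2 -> K => H t (env_tail (env_tail e)))).
      by apply: (@polyfam_tail _ _ (fun e => H t (env_tail e))); exact: polyfam_tail.
    by apply: polyfun_add; exact: polyfun_var.
  have [P hP eP] := polyfun_coefs hf; exists P; split=> // r e y.
  by rewrite -eP !env_consK !env_cons0.
have /choice[d hd] : forall t, exists d, forall e, (size (H' t e) <= d)%N.
  by move=> t; have [[_ [d hd]] _] := hH' t; exists d.
pose D := (\max_t d t)%N.
have sH' t e : (size (H' t e) <= D)%N by apply: leq_trans (hd t e) _; exact: leq_bigmax.
have eH' t y r e : (H' t (env_cons r e)).[y] = (H t e).[r + y] by rewrite (hH' t).2.
have [th th0 th1] := exists_dv_gt1 v.
have [us hus sus] := exists_residue_list closedK v (#|{: bool * 'I_m}| * D).+1.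
pose lhs e := test_lhs (crit_lhs H' e) (@crit_exp _ D) th.
pose rhs e := test_rhs (crit_rhs H' e) (@crit_exp _ D) th.
pose ex := test_exp (@crit_exp (bool * 'I_m)%type D).
have hcoef t k : polyfun (fun e => (H' t e)`_k) by exact: (hH' t).1.1.
have hlhs j : polyfun (fun e => lhs e j).
  case: j => [[[c []]|[c c']]|]; rewrite /lhs /= /crit_lhs; last exact: polyfun_cst.
  - exact: hcoef.
  - by apply: polyfun_mul; [exact: hcoef | exact: polyfun_cst].
  - by apply: polyfun_mul; apply: polyfun_exp; exact: hcoef.
have hrhs j : polyfun (fun e => rhs e j).
  case: j => [[[c []]|[c c']]|]; rewrite /rhs /= /crit_rhs; last exact: polyfun_cst.
  - by apply: polyfun_mul; [exact: hcoef | exact: polyfun_cst].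
  - exact: hcoef.
  - by apply: polyfun_mul; apply: polyfun_exp; exact: hcoef.
pose R j e := (lhs e j)%:P * 'X^(ex j) - (rhs e j)%:P.
have hR j : polyfam (R j).
  apply: polyfam_add.
    by apply: polyfam_mul; [exact: polyfam_polyC | exact: polyfam_cst].
  apply: polyfam_ext (polyfam_polyC (polyfun_opp (hrhs j))) => e.
  by rewrite polyCN.
have hcand q : polyfam (root_candidate H q).
  by case: q => [t|] /=; [exact: hH | exact: polyfam_cst].
(* Both remaining quantifiers range over roots: r of a candidate polynomial, then s of the test
   equation [R j]. The first alternative covers a witness that is itself the root r. *)
pose Y u q j e := root_candidate H q e != 0 /\ exists2 r, root (root_candidate H q e) r &
  (X (env_cons r e) \/ (R j (env_cons r e) != 0 /\
     exists2 s, root (R j (env_cons r e)) s & X (env_cons (r + s * u) e))).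
have hY u q j : qf v (Y u q j).
  pose X2 (e : 'I_n.+2 -> K) := X (env_cons (env_tail e ord0 + e ord0 * u) (env_tail (env_tail e))).
  have hX2 : qf v X2.
    apply: (qf_subst (s := fun i e => env_cons (env_tail e ord0 + e ord0 * u)
      (env_tail (env_tail e)) i)) => // i.
    apply: (polyfun_env_cons (s := fun i e => env_tail (env_tail e) i)) => [|k].
      apply: polyfun_add; first exact: polyfun_var.
      by apply: polyfun_mul; [exact: polyfun_var | exact: polyfun_cst].
    exact: polyfun_var.
  have h := qf_exists_root closedK (hcand q) (qf_or hX (qf_exists_root closedK (hR j) hX2)).
  have e2 r s e : X2 (env_cons s (env_cons r e)) = X (env_cons (r + s * u) e).
    by rewrite /X2 !env_consK !env_cons0.
  apply: qf_ext h => e; split=> -[q0 [r hr [hx|[R0 [s hs hx]]]]]; split=> //;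
    exists r => //; [by left | right | by left | right]; split=> //; exists s => //;
    by rewrite ?e2 // -e2.
have h : qf v (fun e => exists (t : 'I_(size us) * option (bool * 'I_m) * test_index _),
    Y (nth 0 us t.1.1) t.1.2 t.2 e).
  by apply: qf_exists => t.
apply: qf_ext h => e; split=> [[t [_ [r _ [hx|[_ [s _ hx]]]]]]|[y hy]].
- by exists r.
- by exists (r + s * nth 0 us t.1.1).
have us0 : (#|{: bool * 'I_m}| * D < size us)%N by rewrite sus.
have [q [r [q0 hr hyr]]] := exists_equivalent_test_point eH' sH' th0 th1 hus us0 e y.
case: hyr => [yr|[j [s [u uus [l0 ex0 hs hcmp]]]]].
  have us_gt0 : (0 < size us)%N by rewrite sus.
  (* The witness is the root itself, so the residue and the test equation may be chosen
     arbitrarily. *)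
  exists (Ordinal us_gt0, q, None); split=> //; exists r => //; left; by rewrite -yr.
have uus' : (index u us < size us)%N by rewrite index_mem.
exists (Ordinal uus', q, j); split=> //; exists r => //; right; rewrite /= nth_index //.
split.
  apply/eqP => /(congr1 (fun p : {poly K} => p`_(ex j))).
  rewrite coefB coefCM coefXn eqxx mulr1 coefC coef0 eqn0Ngt ex0 subr0.
  by apply/eqP.
exists s; first by rewrite /root hornerD hornerN hornerM !hornerC hornerXn hs subrr.
apply/eB; move/eB: hy; apply: hB => i im.
by have := hcmp (true, Ordinal im) (false, Ordinal im).
Qed.

End QuantifierElimination.

(** * Definable sets *)

Section Renaming.
Variables (L : signature) (M : Type) (S : structure_on L M).

Fixpoint trename n m (f : 'I_n -> 'I_m) (t : term L n) : term L m :=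
  match t with
  | TVar i => TVar L (f i)
  | TApp g ts => TApp (fun j => trename f (ts j))
  end.

Definition lift_renaming n m (f : 'I_n -> 'I_m) : 'I_n.+1 -> 'I_m.+1 :=
  fun i => oapp (fun j => lift ord0 (f j)) ord0 (unlift ord0 i).

Fixpoint frename n (phi : formula L n) : forall m, ('I_n -> 'I_m) -> formula L m :=
  match phi in formula _ n return forall m, ('I_n -> 'I_m) -> formula L m with
  | FFalse _ => fun m f => FFalse L m
  | FEq _ s t => fun m f => FEq (trename f s) (trename f t)
  | FRel _ _ ts => fun m f => FRel (fun j => trename f (ts j))
  | FImp _ p q => fun m f => FImp (frename p f) (frename q f)
  | FAll _ p => fun m f => FAll (frename p (lift_renaming f))
  end.

Lemma teval_trename n m (f : 'I_n -> 'I_m) t e :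
  teval S e (trename f t) = teval S (e \o f) t.
Proof. by elim: t => //= g ts IH; congr (fint _ _); apply/funext. Qed.

Lemma env_cons_lift_renaming n m (f : 'I_n -> 'I_m) (a : M) e :
  env_cons a e \o lift_renaming f = env_cons a (e \o f).
Proof.
apply/funext => i; rewrite /= /lift_renaming; case: (unliftP ord0 i) => [j|] -> /=.
  by rewrite !env_consS.
by rewrite !env_cons0.
Qed.

Lemma holds_frename n (phi : formula L n) m (f : 'I_n -> 'I_m) e :
  holds S (frename phi f) e = holds S phi (e \o f).
Proof.
elim: phi m f e => {n} [n|n s t|n r ts|n p IHp q IHq|n p IHp] m f e //=.
- by rewrite !teval_trename.
- by congr (rint _ _); apply/funext => i; rewrite teval_trename.
- by rewrite IHp IHq.
by apply/propext; split=> h a; move: (h a); rewrite IHp env_cons_lift_renaming.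
Qed.

End Renaming.

Section PureFormulas.
Variables (L : signature) (K : valued_expansion L).
Hypotheses (pureK : pure K) (closedK : GRing.closed_field_axiom K).

Lemma polyfun_teval n (t : term (vf_language L) n) :
  polyfun (fun e => teval (vf_structure K) e t).
Proof.
elim: t => [i|f ts IH] /=; first exact: polyfun_var.
case: f ts IH => [[]|f] ts IH /=; last by case: (pureK.1 f).
- exact: polyfun_add.
- exact: polyfun_opp.
- exact: polyfun_mul.
- exact: polyfun_cst.
- exact: polyfun_cst.
Qed.

Lemma qf_holds n (phi : formula (vf_language L) n) :
  qf (vf_val K) (holds (vf_structure K) phi).
Proof.
elim: phi => {n} [n|n s t|n r ts|n p hp q hq|n p hp] /=.
- exact: qf_cst.
- apply: qf_ext (qf_eq0 _ (polyfun_add (polyfun_teval s) (polyfun_opp (polyfun_teval t)))).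
  by move=> e; split=> [/eqP|->]; [rewrite subr_eq0 => /eqP | rewrite subrr].
- case: r ts => [r|r] ts /=; last by case: (pureK.2 r).
  exact: (qf_dv _ (polyfun_teval (ts ord0)) (polyfun_teval (ts ord_max))).
- apply: qf_ext (qf_or (qf_not hp) hq) => e; split=> [[h /h|h _]|h] //.
  by have [hp'|hp'] := pselect (holds (vf_structure K) p e); [right; exact: h | left].
apply: qf_ext (qf_not (qf_exists_env closedK (qf_not hp))) => e.
by rewrite -forallNE; split=> h a; move: (h a); rewrite notK.
Qed.

End PureFormulas.

(** * Interior points of infinite definable sets *)

Section Tameness.
Variables (K : fieldType) (closedK : GRing.closed_field_axiom K).
Variables (Gamma : orderedGroupType) (v : valuation K Gamma).
Local Notation "x <=v y" := (dv v x y) (at level 70).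

Lemma polyfun_poly_arg n (f : ('I_n -> K) -> K) (s : 'I_n -> {poly K}) :
  polyfun f -> exists p : {poly K}, forall x, f (fun i => (s i).[x]) = p.[x].
Proof.
elim=> [i|c|{}f g _ [p hp] _ [q hq]|{}f g _ [p hp] _ [q hq]].
- by exists (s i).
- by exists c%:P => x; rewrite hornerC.
- by exists (p + q) => x; rewrite hp hq hornerD.
- by exists (p * q) => x; rewrite hp hq hornerM.
Qed.

Lemma near0_horner_shift (p : {poly K}) x y : y != 0 ->
  near0 v (fun h => ~~ (p.[x + h] - p.[x] <=v y)).
Proof.
move=> y0; have := near0_horner v (p \Po ('X + x%:P)) y0.
apply: near0_mono => h.
by rewrite -horner_coef0 !horner_comp !hornerD !hornerX !hornerC add0r [h + x]addrC.
Qed.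

(** Away from the roots of the nonzero polynomials involved, their values do not vanish and hence
    keep their valuations under small shifts. The curve [s] has coordinate X at the variable and
    constants at the parameters when it is applied. *)
Lemma qf_locally_constant n (X : ('I_n -> K) -> Prop) (s : 'I_n -> {poly K}) :
  qf v X -> exists C : seq K, forall x, x \notin C ->
    near0 v (fun h => X (fun i => (s i).[x + h]) <-> X (fun i => (s i).[x])).
Proof.
elim=> [f g /(@polyfun_poly_arg _ _ s)[p hp] /(@polyfun_poly_arg _ _ s)[q hq]||].
- exists (poly_roots closedK p ++ poly_roots closedK q) => x.
  rewrite mem_cat negb_or => /andP[px qx].
  suff : near0 v (fun h => (p.[x + h] <=v q.[x + h]) = (p.[x] <=v q.[x])).
    by apply: near0_mono => h; rewrite !hp !hq => ->.
  have horner_split (r : {poly K}) h : r.[x + h] = r.[x] + (r.[x + h] - r.[x]).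
    by rewrite addrCA subrr addr0.
  (* The list [poly_roots] of the zero polynomial says nothing, so zero polynomials are treated
     separately. *)
  have [->|q0] := eqVneq q 0; first by apply: near0W => h; rewrite !horner0 !dvr0.
  have qx0 : q.[x] != 0 by move: qx; rewrite mem_poly_roots.
  have [->|p0] := eqVneq p 0.
    apply: near0_mono (near0_horner_shift q x qx0) => h hq'.
    by rewrite !horner0 (horner_split q) dvDr.
  have px0 : p.[x] != 0 by move: px; rewrite mem_poly_roots.
  apply: near0_mono (near0_and (near0_horner_shift p x px0) (near0_horner_shift q x qx0)).
  by move=> h [hp' hq']; rewrite (horner_split p) (horner_split q) dvDl // dvDr.
- move=> {}X _ [C hC]; exists C => x /hC; apply: near0_mono => h hX.
  by split=> nX /hX.
move=> {}X Y _ [C hC] _ [C' hC']; exists (C ++ C') => x.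
rewrite mem_cat negb_or => /andP[/hC h1 /hC' h2].
by apply: near0_mono (near0_and h1 h2) => h [hX hY]; split=> -[/hX ? /hY ?].
Qed.

End Tameness.

Lemma infinite_set_avoid (T : choiceType) (X C : set T) :
  infinite_set X -> finite_set C -> exists2 x, X x & ~ C x.
Proof.
move=> iX fC; apply: contrapT => h; apply: iX; apply: sub_finite_set fC => x Xx.
by apply: contrapT => nC; apply: h; exists x.
Qed.

(** The common consequence of both alternatives on K through which the group argument proceeds: an
    infinite definable subset of K has an interior point. *)
Definition infinite_definable_has_ball (L : signature) (K : valued_expansion L) : Prop :=
  forall X : set K, definable (vf_structure K) (set_as_unary X) -> infinite_set X ->
  exists2 x, X x & near0 (vf_val K) (fun h => X (x + h)).

Lemma pure_closed_has_ball (L : signature) (K : valued_expansion L) :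
  pure K -> GRing.closed_field_axiom K -> infinite_definable_has_ball K.
Proof.
move=> pureK closedK X [k [phi [a [_ hX]]]] iX.
pose s (i : 'I_(1 + k)) : {poly K} :=
  match fintype.split i with inl _ => 'X | inr j => (a j)%:P end.
have sE x : (fun i => (s i).[x]) = env_cat (fun=> x) a.
  apply/funext => i; rewrite /s /env_cat; case: fintype.split => j.
    by rewrite hornerX.
  by rewrite hornerC.
have [C hC] := qf_locally_constant closedK s (qf_holds pureK closedK phi).
have [x Xx Cx] := infinite_set_avoid iX (finite_seq C).
exists x => //; apply: near0_mono (hC x (introN idP Cx)) => h; rewrite !sE -!hX.
by move=> hx; apply/hx.
Qed.

Section OneHMinimal.
Variables (K : fieldType) (Gamma : orderedGroupType) (v : valuation K Gamma).
Local Notation "x <=v y" := (dv v x y) (at level 70).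

(** For lam >= 0 the set 1 + I_lam is a group: (1+w)(1+u) = 1 + (w+u+wu) gives one inclusion, and
    (u-w)/(1+w) the other. *)
Lemma rv_mul (lam : Gamma) (x w : K) :
  0 <= lam -> lt_oo (Some lam) (v w) -> rv v lam (x * (1 + w)) = rv v lam x.
Proof.
move=> lam0; have [d hd] := val_surj v lam; rewrite -hd => hw.
have d1 : 1 <=v d by rewrite /dv valuation1 hd.
have IE u : I_ideal v lam u <-> ~~ (u <=v d) by rewrite /I_ideal /= -hd.
have unit1 : (1 + w <=v 1) && (1 <=v 1 + w).
  have w1 : ~~ (w <=v 1) by apply: contra hw => h; exact: dv_trans h d1.
  by rewrite dvDl // dvDr // dv_refl.
have w0 : 1 + w != 0 by case/andP: unit1 => h _; apply: dv_neq0 h (oner_neq0 K).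
apply/seteqP; split=> _ [u /IE hu <-].
  exists (w + u + w * u); last by ring.
  apply/IE; apply: dvD_lt; first exact: dvD_lt.
  rewrite mulrC; apply: contra hu => /(dv_trans _); apply.
  rewrite -{1}[u]mulr1; apply: dvMl; apply: dvNge; apply: contra hw => h.
  exact: dv_trans h d1.
exists ((u - w) / (1 + w)).
  apply/IE; have : ~~ (u - w <=v d) by apply: dvD_lt => //; rewrite dvNl.
  apply: contra => h; rewrite -[u - w](divfK w0) -[d]mulr1.
  by apply: dvM => //; case/andP: unit1.
by field.
Qed.

(** If v(h) > v(x - c) + lam, then x + h - c = (x - c)(1 + h/(x - c)) has the same image in RV_lam
    as x - c; finitely many c give finitely many such bounds on h. *)
Lemma prepares_ball (lam : Gamma) (C X : set K) x : 0 <= lam -> finite_set C ->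
  prepares v lam C X -> X x -> ~ C x -> near0 v (fun h => X (x + h)).
Proof.
move=> lam0 /finite_seqP[s ->] hp Xx Cx.
have [d hd] := val_surj v lam.
have d0 : d != 0 by apply/eqP => /(val_eq_oo v); rewrite hd.
have hs : near0 v (fun h => forall c, c \in s -> ~~ (h <=v (x - c) * d)).
  apply: near0_all => c cs; apply: near0_gt; rewrite mulf_neq0 // subr_eq0.
  by apply/eqP => xc; apply: Cx; rewrite xc.
apply: near0_mono hs => h hs; apply/(hp x) => // c cs.
have xc : x - c != 0 by rewrite subr_eq0; apply/eqP => xc; apply: Cx; rewrite xc.
have -> : x + h - c = (x - c) * (1 + h / (x - c)).
  by rewrite mulrDr mulr1 mulrCA divff // mulr1 addrAC.
rewrite rv_mul // -hd; apply: contra (hs c cs) => hc.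
by rewrite -[h](divfK xc) mulrC; apply: dvMl.
Qed.

Lemma dv_natr n : 1 <=v n%:R.
Proof. by elim: n => [|n IH]; [exact: dvr0 | rewrite mulrS dvD // dv_refl]. Qed.

End OneHMinimal.

Lemma one_h_minimal_has_ball (L : signature) (K : valued_expansion L) :
  one_h_minimal K -> infinite_definable_has_ball K.
Proof.
move=> minK X [k [phi [a [_ hX]]]] iX.
have [th th0] := exists_dv_gt1 (vf_val K).
rewrite /dv valuation1; case E : (vf_val K th) => [lam|]; last first.
  by move/(val_eq_oo (vf_val K))/eqP: E; rewrite (negPf th0).
move=> /= lam_gt.
have lam0 : 0 < lam by rewrite lt_neqAle; have := og_total lam 0; rewrite (negPf lam_gt) /= => ->;
  rewrite andbT; apply: contraNneq lam_gt => <-.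
(* All parameters are taken from K, so the number of imaginary ones is 0; n = 1 with v(1) = 0, and
   the class of 0 is chosen as xi. *)
have Xdef : eq_definable_over (vf_structure K) setT
    (RV (vf_val K) 0 `|` [set rv (vf_val K) lam 0]) (set_as_unary X).
  pose f := cast_ord (congr1 (addn 1) (esym (addn0 k))).
  exists k, 0%N, (frename phi f), a, (fun=> set0); split=> // [[]//|b _ x].
  apply: iff_trans (hX x) _; rewrite holds_frename.
  suff -> : env_cat x a = env_cat x (env_cat a b) \o f by [].
  apply/funext => i /=; rewrite -(splitK i) /env_cat unsplitK.
  case: (fintype.split i) => j /=.
    by rewrite (_ : f _ = lshift _ j) ?(unsplitK (inl _)) //; exact: val_inj.
  rewrite (_ : f _ = rshift 1 (lshift 0 j)); last exact: val_inj.
  by rewrite (unsplitK (inr _)) (unsplitK (inl _)).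
have [m [mu [C [m1 hmu fC _ prepC]]]] :=
  minK K (fun phi h => h) 1%N 0 isT (valuation1 _) lam lam0 setT _ (imageT _ _) X Xdef.
have lmu : 0 <= lam + mu.
  have := dv_natr (vf_val K) m; rewrite /dv valuation1 hmu /= => mu0.
  by apply: le_trans (ltW lam0) _; have := og_translate lam mu0; rewrite add0r addrC.
have [x Xx Cx] := infinite_set_avoid iX fC.
by exists x => //; exact: prepares_ball lmu fC prepC Xx Cx.
Qed.

(** * Closure properties of definable sets *)

Section DefinableFamilies.
Variables (L : signature) (M : Type) (S : structure_on L M) (m0 : M).

Definition param_env I (x : I -> M) (u : I + M) : M :=
  match u with inl i => x i | inr a => a end.

(* [definable] with variables indexed by an arbitrary type, which avoids most
   renamings; see [definable_dfb]. *)
Definition dfb I (X : (I -> M) -> Prop) : Prop :=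
  exists N (phi : formula L N) (s : 'I_N -> I + M),
    forall x, X x <-> holds S phi (param_env x \o s).

Lemma dfb_ext I (X Y : (I -> M) -> Prop) : (forall x, X x <-> Y x) -> dfb X -> dfb Y.
Proof. by move=> h; have -> : X = Y by apply/funext => x; exact/propext. Qed.

Lemma dfb_subst I J (f : I -> J + M) (X : (I -> M) -> Prop) :
  dfb X -> dfb (fun x : J -> M => X (param_env x \o f)).
Proof.
move=> [N [phi [s h]]].
exists N, phi, (fun j => match s j with inl i => f i | inr a => inr a end) => x.
rewrite h; set e1 := _ \o s; set e2 := _ \o _.
have -> : e1 = e2 by apply/funext => j; rewrite /e1 /e2 /=; case: (s j).
by [].
Qed.

Lemma dfb_reindex I J (f : I -> J) (X : (I -> M) -> Prop) :
  dfb X -> dfb (fun x : J -> M => X (x \o f)).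
Proof. by move=> /(dfb_subst (inl \o f)). Qed.

Lemma dfb_imp I (X Y : (I -> M) -> Prop) :
  dfb X -> dfb Y -> dfb (fun x => X x -> Y x).
Proof.
move=> [N [phi [s h]]] [N' [phi' [s' h']]].
exists (N + N')%N, (FImp (frename phi (@lshift N N')) (frename phi' (@rshift N N'))).
exists (fun j => match fintype.split j with inl i => s i | inr i => s' i end) => x /=.
rewrite !holds_frename h h'.
set e1 := _ \o s; set e1' := _ \o s'; set e2 := _ \o _; set e2' := _ \o _.
have -> : e2 = e1 by apply/funext => j; rewrite /e1 /e2 /= (unsplitK (inl j)).
have -> // : e2' = e1'.
by apply/funext => j; rewrite /e1' /e2' /= (unsplitK (inr j)).
Qed.

Lemma dfb_false I : dfb (fun _ : I -> M => False).
Proof. by exists 0%N, (FFalse L 0), (fun=> inr m0). Qed.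

Lemma dfb_not I (X : (I -> M) -> Prop) : dfb X -> dfb (fun x => ~ X x).
Proof. by move=> hX; exact: dfb_imp hX (dfb_false I). Qed.

Lemma dfb_and I (X Y : (I -> M) -> Prop) :
  dfb X -> dfb Y -> dfb (fun x => X x /\ Y x).
Proof.
move=> hX hY; apply: dfb_ext (dfb_not (dfb_imp hX (dfb_not hY))) => x.
split=> [h|[h h'] h2]; last exact: h2.
by split; apply: contrapT => n; apply: h => h'.
Qed.

Lemma dfb_forall I (X : (option I -> M) -> Prop) :
  dfb X -> dfb (fun x : I -> M => forall a, X (oapp x a)).
Proof.
move=> [N [phi [s h]]].
(* Variables of phi assigned to [None] are redirected to the bound variable; the free slots they
   leave behind receive the dummy value [m0]. *)
pose f j := if s j is inl None then ord0 else lift ord0 j.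
pose s' j := match s j with
  inl None => inr m0 | inl (Some i) => inl i | inr a => inr a end.
exists N, (FAll (frename phi f)), s' => x /=.
suff e a : env_cons a (param_env x \o s') \o f = param_env (oapp x a) \o s.
  by split=> hx a; move: (hx a); rewrite holds_frename e h.
apply/funext => j; rewrite /= /f /s'; case E: (s j) => [[i|]|b] /=.
- by rewrite env_consS /= E.
- by rewrite env_cons0.
- by rewrite env_consS /= E.
Qed.

Definition sum_env I J (y : J -> M) (x : I -> M) (u : J + I) : M :=
  match u with inl j => y j | inr i => x i end.

Lemma dfb_forall_ord k I (X : ('I_k + I -> M) -> Prop) :
  dfb X -> dfb (fun x : I -> M => forall y : 'I_k -> M, X (sum_env y x)).
Proof.
elim: k I X => [|k IH] I X hX.
  have h := dfb_subst (fun u : 'I_0 + I => match u with inl _ => inr m0 | inr i => inl i end) hX.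
  apply: dfb_ext h => x.
  have e y : param_env x \o (fun u : 'I_0 + I =>
      match u with inl _ => inr m0 | inr i => inl i end) = sum_env y x.
    by apply/funext => -[[]|].
  by split=> [hx y|hx]; [rewrite -(e y) | rewrite (e (fun=> m0))].
pose f (u : 'I_k.+1 + I) : 'I_k + option I := match u with
  | inl j => oapp inl (inr None) (unlift ord0 j) | inr i => inr (Some i) end.
apply: dfb_ext (dfb_forall (IH _ _ (dfb_reindex f hX))) => x.
have e a y : sum_env y (oapp x a) \o f = sum_env (env_cons a y) x.
  apply/funext => -[j|i] //=; rewrite /f /env_cons.
  by case: (unlift ord0 j).
split=> h; last by move=> a y; rewrite e.
by move=> y; rewrite -(env_cons_eta y) -e.
Qed.

Lemma dfb_exists_ord k I (X : ('I_k + I -> M) -> Prop) :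
  dfb X -> dfb (fun x : I -> M => exists y : 'I_k -> M, X (sum_env y x)).
Proof.
move=> hX; have h := dfb_not (dfb_forall_ord (dfb_not hX)).
apply: dfb_ext h => x; split=> [h|[y hy] h]; last exact: (h y).
by apply: contrapT => n; apply: h => y hy; apply: n; exists y.
Qed.

Lemma dfb_exists I (X : (option I -> M) -> Prop) :
  dfb X -> dfb (fun x : I -> M => exists a, X (oapp x a)).
Proof.
move=> hX; have h := dfb_not (dfb_forall (dfb_not hX)).
apply: dfb_ext h => x; split=> [h|[y hy] h]; last exact: (h y).
by apply: contrapT => n; apply: h => y hy; apply: n; exists y.
Qed.

Lemma definable_dfb m (X : set ('I_m -> M)) : definable S X <-> dfb X.
Proof.
split=> [[k [phi [a [_ h]]]]|[N [phi [s h]]]].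
  exists (m + k)%N, phi.
  exists (fun i => match fintype.split i with inl j => inl j | inr j => inr (a j) end) => x.
  rewrite h; set e1 := env_cat x a; set e2 := _ \o _.
  have -> // : e1 = e2.
  by apply/funext => i; rewrite /e1 /e2 /env_cat /=; case: fintype.split.
(* Each variable of phi gets a parameter slot of its own; slots of variables assigned to coordinates
   are filled with [m0]. *)
pose f (j : 'I_N) : 'I_(m + N) := if s j is inl i then lshift N i else rshift m j.
pose a (j : 'I_N) := if s j is inr b then b else m0.
exists N, (frename phi f), a; split=> // x.
rewrite h holds_frename; set e1 := _ \o s; set e2 := _ \o _.
have -> // : e1 = e2.
apply/funext => j; rewrite /e1 /e2 /f /a /env_cat /=; case E: (s j) => [i|b] /=.
  by rewrite (unsplitK (inl i)).
by rewrite (unsplitK (inr j)) E.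
Qed.

End DefinableFamilies.

Section DefinableValued.
Variables (L : signature) (K : valued_expansion L).
Local Notation S := (vf_structure K).
Local Notation v := (vf_val K).

Let term_pair N N' (t : term (vf_language L) N) (t' : term (vf_language L) N')
    (i : 'I_2) : term (vf_language L) (N + N') :=
  if i == ord0 then trename (@lshift N N') t else trename (@rshift N N') t'.

(** The concatenation of two assignments of variables, not a valuation of a field. *)
Let sum_valuation N N' (T : Type) (s : 'I_N -> T) (s' : 'I_N' -> T) (j : 'I_(N + N')) :=
  match fintype.split j with inl i => s i | inr i => s' i end.

Let teval_pair N N' t t' I (s : 'I_N -> I + K) (s' : 'I_N' -> I + K) x :
  let ev := fun i => teval S (param_env x \o sum_valuation s s') (term_pair t t' i) in
  ev ord0 = teval S (param_env x \o s) t /\ ev ord_max = teval S (param_env x \o s') t'.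
Proof.
rewrite /term_pair /= !teval_trename.
set e1 := _ \o @lshift _ _; set e2 := _ \o @rshift _ _.
have -> : e1 = param_env x \o s.
  by apply/funext => j; rewrite /e1 /sum_valuation /= (unsplitK (inl j)).
have -> // : e2 = param_env x \o s'.
by apply/funext => j; rewrite /e2 /sum_valuation /= (unsplitK (inr j)).
Qed.

Lemma polyfun_term n (f : ('I_n -> K) -> K) : polyfun f ->
  exists N (t : term (vf_language L) N) (s : 'I_N -> 'I_n + K),
    forall x, teval S (param_env x \o s) t = f x.
Proof.
elim=> [i|c|{}f g _ [N [t [s h]]] _ [N' [t' [s' h']]]
           |{}f g _ [N [t [s h]]] _ [N' [t' [s' h']]]].
- by exists 1%N, (TVar _ ord0), (fun=> inl i).
- by exists 1%N, (TVar _ ord0), (fun=> inr c).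
- exists (N + N')%N, (@TApp (vf_language L) _ (inl SAdd) (term_pair t t')).
  exists (sum_valuation s s') => x; rewrite -h -h' /=.
  by have [-> ->] := teval_pair t t' s s' x.
- exists (N + N')%N, (@TApp (vf_language L) _ (inl SMul) (term_pair t t')).
  exists (sum_valuation s s') => x; rewrite -h -h' /=.
  by have [-> ->] := teval_pair t t' s s' x.
Qed.

Lemma qf_dfb n (X : ('I_n -> K) -> Prop) : qf v X -> dfb S X.
Proof.
elim=> [f g /polyfun_term[N [t [s h]]] /polyfun_term[N' [t' [s' h']]]|{}X _|{}X Y _ + _].
- exists (N + N')%N, (@FRel (vf_language L) _ (inl SDiv) (term_pair t t')).
  exists (sum_valuation s s') => x; rewrite -h -h' /=.
  by have [-> ->] := teval_pair t t' s s' x.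
- exact: (dfb_not 0).
- exact: (dfb_and 0).
Qed.

End DefinableValued.

(** * Uniformly discrete definable sets *)

Section UniformlyDiscrete.
Variables (L : signature) (K : valued_expansion L).
Hypothesis ballK : infinite_definable_has_ball K.
Local Notation S := (vf_structure K).
Local Notation v := (vf_val K).
Local Notation "x <=v y" := (dv v x y) (at level 70).

(** The valuations of the nonzero elements of a finite set are bounded, while nonzero elements
    beyond any bound satisfy Q. *)
Lemma near0_infinite (Q : K -> Prop) : near0 v Q -> infinite_set [set h | Q h].
Proof.
move=> nQ /finite_seqP[s sE].
have ns : near0 v (fun h => forall x, x \in s -> x != 0 -> ~~ (h <=v x)).
  apply: near0_all => x _; have [->|x0] := eqVneq x 0; first exact: near0W.
  by apply: near0_mono (near0_gt v x0).
have [h h0 [Qh hs]] := near0_ex (near0_and nQ ns).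
have hin : h \in s by have : [set h | Q h] h by []; rewrite sE.
by have := hs h hin h0; rewrite dv_refl.
Qed.

Definition uniformly_discrete m (d : K) (X : set ('I_m -> K)) : Prop :=
  forall x x', X x -> X x' -> x <> x' -> exists i, x i - x' i <=v d.

(* If the first projection of X contains a ball B, then over a small enough B
   the other coordinates of a point of X determine the first one, so the
   remaining coordinates form an infinite uniformly discrete set. *)
Lemma uniformly_discrete_finite m d (X : set ('I_m -> K)) :
  d != 0 -> definable S X -> uniformly_discrete d X -> finite_set X.
Proof.
elim: m X => [|m IH] X d0 /(definable_dfb _ 0) hX dX.
  by apply: sub_finite_set (finite_set1 (fun=> 0)) => x _; apply/funext => -[].
(* If the first coordinates are too close to separate two points, one of the remaining coordinates
   does. *)
have disc a a' y y' : X (env_cons a y) -> X (env_cons a' y') ->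
    ~~ (a - a' <=v d) -> y <> y' -> exists i, y i - y' i <=v d.
  move=> h h' aa' yy'; have [|i] := dX _ _ h h'.
    by move=> /(congr1 (@env_tail _ _)); rewrite !env_consK.
  case: (unliftP ord0 i) => [j ->|->]; rewrite ?env_consS ?env_cons0; first by exists j.
  by rewrite (negPf aa').
pose f J (u : J) (j : 'I_m.+1) : 'I_m + J := oapp inl (inr u) (unlift ord0 j).
have eqf J (u : J) y x : sum_env y x \o f J u = env_cons (x u) y.
  by apply/funext => i; rewrite /f /env_cons /=; case: (unlift ord0 i).
have Yfin : finite_set [set a | exists y, X (env_cons a y)].
  apply: contrapT => Yinf; have [|a0 Ya0 [e e0 he]] := ballK _ Yinf.
    apply/(definable_dfb _ 0).
    apply: dfb_ext (dfb_exists_ord 0 (dfb_reindex (f _ (ord0 : 'I_1)) hX)) => x.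
    by split=> -[y]; rewrite ?eqf => h; exists y; rewrite ?eqf.
  (* The first condition keeps a0 + h in the projection of X; the second makes differences of
     elements of B too small to separate points of X. *)
  pose B h := (e <=v h) /\ ~ (h <=v d).
  have Binf : infinite_set [set h | B h].
    apply: near0_infinite; apply: near0_mono (near0_and (near0_ge v e0) (near0_gt v d0)).
    by move=> h [h1 h2]; split=> //; exact/negP.
  apply: Binf; pose X' := [set y | exists a, B (a - a0) /\ X (env_cons a y)].
  have X'fin : finite_set X'.
    apply: IH => //.
      apply/(definable_dfb _ 0).
      have hB : qf v (fun x : 'I_1 -> K => B (x ord0 - a0)).
        have h1 : polyfun (fun x : 'I_1 -> K => x ord0 - a0).
          by apply: polyfun_add; [exact: polyfun_var | exact: polyfun_cst].
        by apply: qf_and; [|apply: qf_not]; apply: qf_dv => //; exact: polyfun_cst.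
      have h1 := dfb_reindex (fun _ : 'I_1 => None : option 'I_m) (qf_dfb hB).
      have h2 := dfb_reindex (fun j => unlift (ord0 : 'I_m.+1) j) hX.
      have h3 := dfb_exists 0 (dfb_and 0 h1 h2).
      exact: h3.
    move=> y y' [a [[Ba Ba'] Xa]] [a' [[Bb Bb'] Xa']].
    apply: disc Xa Xa' _; have -> : a - a' = (a - a0) + - (a' - a0).
      by rewrite opprB addrA subrK.
    by apply: dvD_lt; rewrite ?dvNl; exact/negP.
  (* A point y determines h: for two different values of h, both the first coordinate and the equal
     remaining ones would fail to separate the points. So g maps the finite set X' onto a set
     containing the infinite B. *)
  pose g y := xget 0 [set h | B h /\ X (env_cons (a0 + h) y)].
  apply: sub_finite_set (finite_image g X'fin) => h Bh.
  have [y hy] : exists y, X (env_cons (a0 + h) y).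
    (* The ball provided by [near0] is punctured; its centre a0 lies in the projection anyway. *)
    have [hh0|h0] := eqVneq h 0.
      by rewrite hh0 addr0.
    by apply: he => //; case: Bh.
  exists y; first by exists (a0 + h); rewrite addrC addKr.
  have [Bg Xg] : B (g y) /\ X (env_cons (a0 + g y) y).
    exact: (@xgetPex _ 0 [set h | B h /\ X (env_cons (a0 + h) y)]) (ex_intro _ h (conj Bh hy)).
  apply: contrapT => gh; have [|i] := dX _ _ Xg hy.
    by move=> /(congr1 (fun x : 'I_m.+1 -> K => x ord0)); rewrite !env_cons0 => /addrI.
  case: (unliftP ord0 i) => [j ->|->]; rewrite ?env_consS ?env_cons0.
    by rewrite subrr dv0r (negPf d0).
  rewrite opprD addrACA subrr add0r; apply/negP; apply: dvD_lt; rewrite ?dvNl; apply/negP.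
    by case: Bg.
  by case: Bh.
(* X is the union of its fibres over the finite first projection, and each fibre is uniformly
   discrete in one dimension less. *)
have : finite_set (\bigcup_(a in [set a | exists y, X (env_cons a y)])
    ((fun y => env_cons a y) @` [set y | X (env_cons a y)])).
  apply: bigcup_finite => // a _; apply: finite_image; apply: IH => //.
    apply/(definable_dfb _ 0).
    have h := dfb_subst (fun j => oapp inl (inr a) (unlift (ord0 : 'I_m.+1) j)) hX.
    apply: dfb_ext h => y.
    suff -> : param_env y \o (fun j => oapp inl (inr a) (unlift (ord0 : 'I_m.+1) j)) = env_cons a y by [].
    by apply/funext => i; rewrite /env_cons /=; case: (unlift ord0 i).
  move=> y y' Xy Xy' yy'; have [|i] := dX _ _ Xy Xy'.
    by move=> /(congr1 (@env_tail _ _)); rewrite !env_consK.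
  case: (unliftP ord0 i) => [j ->|->]; rewrite ?env_consS ?env_cons0; first by exists j.
  by rewrite subrr dv0r (negPf d0).
apply: sub_finite_set => x Xx; rewrite -(env_cons_eta x) in Xx *.
by exists (x ord0); [exists (env_tail x) | exists (env_tail x)].
Qed.

End UniformlyDiscrete.

(** * Congruence subgroups *)

Section CongruenceSubgroups.
Variables (K : fieldType) (Gamma : orderedGroupType) (v : valuation K Gamma).
Local Notation "x <=v y" := (dv v x y) (at level 70).

Definition mx_ge m n (b : K) (A : 'M[K]_(m, n)) : Prop := forall i j, b <=v A i j.
Definition mx_gt m n (b : K) (A : 'M[K]_(m, n)) : Prop := forall i j, ~~ (A i j <=v b).

Lemma mx_gt_ge m n b b' (A : 'M[K]_(m, n)) : b' <=v b -> mx_gt b A -> mx_ge b' A.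
Proof. by move=> bb hA i j; apply: dv_trans bb _; exact: dvNge. Qed.

Lemma mx_gtW m n b b' (A : 'M[K]_(m, n)) : b' <=v b -> mx_gt b A -> mx_gt b' A.
Proof. by move=> bb hA i j; apply: contra (hA i j) => h; exact: dv_trans h bb. Qed.

Lemma mx_gt0 m n b : b != 0 -> mx_gt b (0 : 'M[K]_(m, n)).
Proof. by move=> b0 i j; rewrite mxE dv0r. Qed.

Lemma mx_gtD m n b (A B : 'M[K]_(m, n)) : mx_gt b A -> mx_gt b B -> mx_gt b (A + B).
Proof. by move=> hA hB i j; rewrite mxE; exact: dvD_lt. Qed.

Lemma mx_gtN m n b (A : 'M[K]_(m, n)) : mx_gt b A -> mx_gt b (- A).
Proof. by move=> hA i j; rewrite mxE dvNl. Qed.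

Lemma mulmx_gt m n p a b (A : 'M[K]_(m, n)) (B : 'M[K]_(n, p)) :
  a != 0 -> b != 0 -> mx_ge a A -> mx_gt b B -> mx_gt (a * b) (A *m B).
Proof.
move=> a0 b0 hA hB i j; rewrite mxE; apply: dv_sum_lt => [|k]; first by rewrite mulf_neq0.
apply: contra (hB k j) => h; rewrite -(dvM2l v _ _ a0); apply: dv_trans h.
by apply: dvMr; exact: hA.
Qed.

Lemma mulmx_gt_ge m n p a b (A : 'M[K]_(m, n)) (B : 'M[K]_(n, p)) :
  a != 0 -> b != 0 -> mx_gt a A -> mx_ge b B -> mx_gt (a * b) (A *m B).
Proof.
move=> a0 b0 hA hB i j; rewrite mxE; apply: dv_sum_lt => [|k]; first by rewrite mulf_neq0.
apply: contra (hA i k) => h; rewrite -(dvM2r v _ _ b0); apply: dv_trans h.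
by apply: dvMl; exact: hB.
Qed.

Lemma det_ge1 n (A : 'M[K]_n) : mx_ge 1 A -> 1 <=v \det A.
Proof.
move=> hA; apply: dv_sum => s _; rewrite mulr_sign.
set p := \prod_(i < n) _; have h : 1 <=v p.
  by rewrite /p; elim/big_ind: _ => [|a b|i _]; [exact: dv_refl | exact: dvM_ge1 | exact: hA].
by case: ifP => // _; rewrite dvNr.
Qed.

Lemma adj_ge1 n (A : 'M[K]_n) : mx_ge 1 A -> mx_ge 1 (\adj A).
Proof.
move=> hA i j; rewrite mxE /cofactor; rewrite -signr_odd mulr_sign.
have h : 1 <=v \det (row' j (col' i A)) by apply: det_ge1 => k l; rewrite !mxE.
by case: ifP => // _; rewrite dvNr.
Qed.

Lemma SL_invmx n (g : 'M[K]_n) : \det g = 1 ->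
  [/\ invmx g = \adj g, g *m invmx g = 1%:M & invmx g *m g = 1%:M].
Proof.
move=> dg; have ug : g \in unitmx by rewrite unitmxE dg unitr1.
by rewrite mulmxV // mulVmx // /invmx ug dg invr1 scale1r.
Qed.

(** The intersection of all G-conjugates of the elements of G congruent to 1 beyond c; quantifying
    over conjugates makes it normal and keeps it definable. *)
Definition congruence_subgroup n (G : set 'M[K]_n) (c : K) : set 'M[K]_n :=
  [set h | G h /\ forall k, G k -> mx_gt c (k *m h *m invmx k - 1%:M)].

Lemma congruence_subgroup_normal n (G : set 'M[K]_n) c :
  is_subgroup_SL G -> c != 0 -> 1 <=v c -> normal_subgroup (congruence_subgroup G c) G.
Proof.
move=> [GSL G1 GM GV] c0 c1.
have inv k : G k -> k *m invmx k = 1%:M /\ invmx k *m k = 1%:M.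
  by move=> /GSL/SL_invmx[_ ? ?].
have conjM k h h' : G k ->
    k *m (h *m h') *m invmx k = (k *m h *m invmx k) *m (k *m h' *m invmx k).
  move=> /inv[_ kk]; rewrite !mulmxA; congr (_ *m _ *m _).
  by rewrite -[in RHS](mulmxA (k *m h)) kk mulmx1.
have one_ge1 : mx_ge 1 (1%:M : 'M[K]_n).
  by move=> i j; rewrite mxE; case: (i == j); [exact: dv_refl | exact: dvr0].
split; first split.
- by move=> h [/GSL].
- split=> // k Gk; have [kk _] := inv k Gk.
  by rewrite mulmx1 kk subrr; exact: mx_gt0.
- move=> h h' [Gh hh] [Gh' hh']; split=> [|k Gk]; first exact: GM.
  rewrite conjM //; set A := k *m h *m _; set B := k *m h' *m _.
  have hA : mx_gt c (A - 1%:M) by exact: hh.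
  have hB : mx_gt c (B - 1%:M) by exact: hh'.
  (* Since A - 1 is integral, the product (A-1)(B-1) is as small as B - 1. *)
  have -> : A *m B - 1%:M = (A - 1%:M) *m (B - 1%:M) + (A - 1%:M) + (B - 1%:M).
    have eAB (X Y : 'M[K]_n) : (X + 1%:M) *m (Y + 1%:M) - 1%:M = X *m Y + X + Y.
      by rewrite mulmxDl mulmxDr mulmx1 mul1mx !addrA addrK.
    by rewrite -eAB !subrK.
  apply: mx_gtD => //; apply: mx_gtD => //; rewrite -[c]mul1r.
  by apply: mulmx_gt (oner_neq0 K) c0 (mx_gt_ge c1 hA) hB.
- move=> h [Gh hh]; split=> [|k Gk]; first exact: GV.
  set A := k *m h *m invmx k; set A' := k *m invmx h *m invmx k.
  have hA : mx_gt c (A - 1%:M) by exact: hh.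
  have [kk kk'] := inv k Gk; have [hi hi'] := inv h Gh.
  have A'A : A' *m A = 1%:M by rewrite -conjM // hi' mulmx1.
  have GA : G A by apply: (GM); [exact: GM | exact: GV].
  have A'adj : A' = \adj A.
    have [<- AA _] := SL_invmx (GSL _ GA).
    by rewrite -[A']mulmx1 -AA mulmxA A'A mul1mx.
  (* As c is integral, so is A, and hence its inverse, which is the adjugate because det A = 1. *)
  have -> : A' - 1%:M = - (A' *m (A - 1%:M)).
    by rewrite mulmxBr A'A mulmx1 opprB.
  apply: mx_gtN; rewrite -[c]mul1r; apply: mulmx_gt => //; first exact: oner_neq0.
  rewrite A'adj; apply: adj_ge1 => i j.
  rewrite -[A](subrK 1%:M) mxE; apply: dvD; last exact: one_ge1.
  exact: (mx_gt_ge c1 hA).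
- by move=> h [].
move=> g h Gg [Gh hh]; split=> [|k Gk].
  by apply: (GM); [exact: GM | exact: GV].
have Gkg := GM _ _ Gk Gg.
have -> : k *m (g *m h *m invmx g) *m invmx k = (k *m g) *m h *m invmx (k *m g).
  have [kk kk'] := inv k Gk; have [gg gg'] := inv g Gg; have [kg kg'] := inv _ Gkg.
  have -> : invmx (k *m g) = invmx g *m invmx k.
    have e : k *m g *m (invmx g *m invmx k) = 1%:M.
      by rewrite mulmxA -(mulmxA k) gg mulmx1 kk.
    by rewrite -[LHS]mulmx1 -e mulmxA kg' mul1mx.
  by rewrite !mulmxA.
exact: hh.
Qed.

End CongruenceSubgroups.

Section MatrixCoordinates.
Variables (K : fieldType) (n : nat).

Definition mx_of_coords (x : 'I_(n * n) -> K) : 'M[K]_n := vec_mx (\row_i x i).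

Lemma mx_coordsK : cancel (@mx_coords K n) mx_of_coords.
Proof.
move=> g; rewrite /mx_of_coords -[RHS]mxvecK; congr vec_mx.
by apply/rowP => i; rewrite mxE.
Qed.

Lemma mx_of_coordsK : cancel mx_of_coords (@mx_coords K n).
Proof.
by move=> x; apply/funext => i; rewrite /mx_coords /mx_of_coords vec_mxK mxE.
Qed.

Lemma mx_coords_image (G : set 'M[K]_n) x : (mx_coords (n := n) @` G) x <-> G (mx_of_coords x).
Proof.
split=> [[g Gg <-]|Gx]; first by rewrite mx_coordsK.
by exists (mx_of_coords x); rewrite ?mx_of_coordsK.
Qed.

Lemma mx_coordsE (g : 'M[K]_n) i j : mx_coords g (mxvec_index i j) = g i j.
Proof. by rewrite /mx_coords mxvecE. Qed.

Definition polymx m p q (F : ('I_m -> K) -> 'M[K]_(p, q)) : Prop :=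
  forall i j, polyfun (fun e => F e i j).

Lemma polymx_mul m p q r (F : ('I_m -> K) -> 'M[K]_(p, q)) (G : ('I_m -> K) -> 'M[K]_(q, r)) :
  polymx F -> polymx G -> polymx (fun e => F e *m G e).
Proof.
move=> hF hG i j; under [X in polyfun X]funext do rewrite mxE.
by apply: polyfun_sum => k _; apply: polyfun_mul.
Qed.

Lemma polymx_adj m (F : ('I_m -> K) -> 'M[K]_n) : polymx F -> polymx (fun e => \adj (F e)).
Proof.
move=> hF i j; under [X in polyfun X]funext do rewrite mxE.
apply: polyfun_mul; first exact: polyfun_cst.
apply: polyfun_det => k l; under [X in polyfun X]funext do rewrite !mxE.
exact: hF.
Qed.

Lemma polymx_mx_of_coords m (f : 'I_(n * n) -> 'I_m) :
  polymx (fun e => mx_of_coords (e \o f)).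
Proof.
move=> i j; under [X in polyfun X]funext do rewrite /mx_of_coords mxE mxE.
exact: polyfun_var.
Qed.

End MatrixCoordinates.

(** * Bounded subgroups of the special linear group *)

Section BoundedGroups.
Variables (L : signature) (K : valued_expansion L).
Hypothesis ballK : infinite_definable_has_ball K.
Local Notation S := (vf_structure K).
Local Notation v := (vf_val K).
Local Notation "x <=v y" := (dv v x y) (at level 70).
Variables (n : nat) (G : set 'M[K]_n).
Hypotheses (Ggrp : is_subgroup_SL G) (Gdef : definable_mx G).

Lemma definable_congruence_subgroup c : definable_mx (congruence_subgroup v G c).
Proof.
apply/(definable_dfb _ 0).
have hG : dfb S (fun x : 'I_(n * n) -> K => G (mx_of_coords x)).
  apply: dfb_ext ((definable_dfb _ 0 _).1 Gdef) => x.
  exact: mx_coords_image.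
pose N := (n * n)%N.
(* The first half of w is the conjugating matrix k, the second half is h. With the adjugate in place
   of the inverse, which agrees with it on SL_n, the condition becomes polynomial. *)
pose W (w : 'I_(N + N) -> K) := forall i j,
  ~ ((mx_of_coords (w \o @lshift N N) *m mx_of_coords (w \o @rshift N N)
      *m \adj (mx_of_coords (w \o @lshift N N)) - 1%:M) i j <=v c).
have hW : qf v W.
  apply: qf_forall => i; apply: qf_forall => j; apply: qf_not.
  apply: qf_dv; last exact: polyfun_cst.
  under [X in polyfun X]funext do rewrite mxE.
  apply: polyfun_add; last exact: polyfun_cst.
  have hl := @polymx_mx_of_coords K n _ (@lshift N N).
  have hr := @polymx_mx_of_coords K n _ (@rshift N N).
  exact: (polymx_mul (polymx_mul hl hr) (polymx_adj hl)).
have h1 := dfb_reindex (@fintype.split N N) (qf_dfb hW).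
have h2 := dfb_reindex (inl : 'I_N -> 'I_N + 'I_N) hG.
have h3 := dfb_and 0 hG (dfb_forall_ord 0 (dfb_imp h2 h1)).
have el y x : (sum_env y x \o @fintype.split N N) \o @lshift N N = y.
  by apply/funext => k; rewrite /= (unsplitK (inl k)).
have er y x : (sum_env y x \o @fintype.split N N) \o @rshift N N = x.
  by apply/funext => k; rewrite /= (unsplitK (inr k)).
have adjE k : G k -> \adj k = invmx k.
  by case: Ggrp => GSL _ _ _ /GSL/SL_invmx[].
apply: dfb_ext h3 => x; split=> [[Gx hx]|/mx_coords_image[Gx hx]].
  apply/mx_coords_image; split=> // k Gk i j; apply/negP.
  have := hx (mx_coords k) _ i j; rewrite el er mx_coordsK (adjE _ Gk); apply.
  exact: Gk.
split=> // y Gy i j; rewrite el er (adjE _ Gy); apply/negP.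
exact: hx.
Qed.

(** Otherwise G would be uniformly discrete with constant d/b: if all entries of g' - g have
    valuation above v(d/b), then g^-1 g' is close to 1, because the entries of g^-1 have valuation
    at least v(b). Uniformly discrete definable sets are finite. *)
Lemma exists_close_to_one : infinite_set G -> bounded_mx G ->
  exists2 b, (b != 0) /\ (forall g, G g -> mx_ge v b g) &
  forall d, d != 0 -> exists h, [/\ G h, h <> 1%:M & mx_gt v d (h - 1%:M)].
Proof.
move=> Ginf [gam hgam]; have [b hb] := val_surj v gam.
have b0 : b != 0 by apply/eqP => /(val_eq_oo v); rewrite hb.
have Gb g : G g -> mx_ge v b g.
  move=> Gg i j; rewrite -mx_coordsE; apply: dvNge; rewrite /dv hb.
  by apply: hgam; exists g.
exists b => // d d0.
have db0 : d / b != 0 by rewrite mulf_neq0 ?invr_eq0.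
apply: contrapT => nh.
have : finite_set (mx_coords (n := n) @` G).
  apply: (uniformly_discrete_finite ballK db0 Gdef) => _ _ [g Gg <-] [g' Gg' <-] gg'.
  apply: contrapT => nclose; apply: nh.
  have [GSL G1 GM GV] := Ggrp; have [_ gi ig] := SL_invmx (GSL _ Gg).
  exists (invmx g *m g'); split.
  - by apply: GM => //; exact: GV.
  - by move=> e; apply: gg'; rewrite -[g']mul1mx -gi -mulmxA e mulmx1.
  have -> : invmx g *m g' - 1%:M = invmx g *m (g' - g) by rewrite mulmxBr ig.
  rewrite -[d](divfK b0) mulrC; apply: mulmx_gt => //; first exact: Gb (GV _ Gg).
  move=> i j; apply/negP => h; apply: nclose; exists (mxvec_index i j).
  by rewrite !mx_coordsE -dvNl opprB; move: h; rewrite !mxE.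
move=> /(finite_image (@mx_of_coords K n)) hfin; apply: Ginf; apply: sub_finite_set hfin.
by move=> g Gg; exists (mx_coords g); [exists g | exact: mx_coordsK].
Qed.

Lemma bounded_not_almost_simple :
  infinite_set G -> bounded_mx G -> ~ definably_almost_simple G.
Proof.
move=> Ginf Gbd Gsimple; apply: Gsimple.
have [b [b0 Gb] close1] := exists_close_to_one Ginf Gbd.
have [GSL G1 GM GV] := Ggrp.
have [g Gg g1] := infinite_set_avoid Ginf (finite_set1 (1%:M : 'M[K]_n)).
have [i [j gij]] : exists i j, (g - 1%:M) i j != 0.
  apply: contrapT => h; apply: g1; apply/eqP; rewrite -subr_eq0; apply/eqP/matrixP => i j.
  by rewrite [RHS]mxE; apply/eqP; apply: contrapT => /negP hij; apply: h; exists i, j.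
(* An integral c whose valuation is at least that of a nonzero entry of g - 1, so that g itself is
   left out of the subgroup. *)
pose c := if 1 <=v (g - 1%:M) i j then (g - 1%:M) i j else 1.
have c0 : c != 0 by rewrite /c; case: ifP => // _; exact: oner_neq0.
have c1 : 1 <=v c by rewrite /c; case: ifP => // _; exact: dv_refl.
have gc : (g - 1%:M) i j <=v c.
  by rewrite /c; case: ifP => [_|/negbT]; [exact: dv_refl | exact: dvNge].
exists (congruence_subgroup v G c); split.
- exact: congruence_subgroup_normal.
- move=> e; have : congruence_subgroup v G c g by rewrite e.
  move=> [_ /(_ _ G1)]; rewrite invmx1 mul1mx mulmx1 => /(_ i j); by rewrite gc.
(* If the subgroup were a finite list s, then w would bound the valuations of all nonzero entries of
   the h - 1 with h in s. An element of G closer to 1 than both w and c / b^2 belongs to the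
   subgroup, as conjugation costs at most the factor b^2, and yet lies outside the list. *)
- move=> /finite_seqP[s sE].
  pose entries := [seq (h - 1%:M) ij.1 ij.2 | h <- s, ij <- enum (('I_n * 'I_n)%type : finType)].
  have [w w0 hw] := exists_upper_bound v entries.
  have cb0 : c / (b * b) != 0 by rewrite mulf_neq0 ?invr_eq0 ?mulf_neq0.
  have [d d0 [wd cd]] := near0_ex (near0_and (near0_ge v w0) (near0_ge v cb0)).
  have [h [Gh h1 hd]] := close1 d d0.
  have Hh : congruence_subgroup v G c h.
    split=> // k Gk; have [_ kk _] := SL_invmx (GSL _ Gk).
    have -> : k *m h *m invmx k - 1%:M = k *m (h - 1%:M) *m invmx k.
      by rewrite mulmxBr mulmx1 mulmxBl kk.
    apply: mx_gtW (_ : mx_gt v (b * (c / (b * b)) * b) _).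
      by rewrite mulrAC mulrC divfK ?dv_refl ?mulf_neq0.
    apply: mulmx_gt_ge => //; [by rewrite mulf_neq0 | | exact: Gb (GV _ Gk)].
    by apply: mulmx_gt => //; [exact: Gb | exact: mx_gtW hd].
  have hs : h \in s by have := Hh; rewrite sE.
  apply: h1; apply/eqP; rewrite -subr_eq0; apply/eqP/matrixP => k l; rewrite [RHS]mxE.
  apply/eqP; apply: contraT => hkl; case/negP: (hd k l); apply: dv_trans wd.
  apply: hw hkl; apply/allpairsP; exists (h, (k, l)); split=> //=.
  by rewrite mem_enum.
exact: definable_congruence_subgroup.
Qed.

End BoundedGroups.

Theorem proposition4p2p1 (L : signature) (K : valued_expansion L)
    (hK : ([pchar K] =i pred0 /\ henselian (vf_val K) /\ one_h_minimal K) \/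
          (pure K /\ GRing.closed_field_axiom K /\ exists p, p \in [pchar K]))
    (n : nat) (G : set 'M[K]_n)
    (Ggrp : is_subgroup_SL G)
    (Gdef : definable_mx G)
    (Ginf : infinite_set G)
    (Gsimple : definably_almost_simple G) :
  ~ bounded_mx G.
Proof.
move=> Gbd; have ballK : infinite_definable_has_ball K.
  case: hK => [[_ [_ minK]]|[pureK [closedK _]]]; first exact: one_h_minimal_has_ball.
  exact: pure_closed_has_ball.
exact: bounded_not_almost_simple Gsimple.
Qed.
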